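(* Let $p_1$ and $p_2$ be two multiplicatively independent natural numbers. Let $f\in\mathbb{C}[[x]]$ be a $p_1$-Mahler function and let $g\in\mathbb{C}[[x]]$ be a $p_2$-Mahler function. Then $f$ and $g$ are algebraically independent over $\mathbb{C}(x)$, unless one of them is a rational function.
   Context: For an integer $p\ge2$, a power series $f(x)\in\mathbb{C}[[x]]$ is a $p$-Mahler function if there exist polynomials $a_0(x),\dots,a_n(x)\in\mathbb{C}[x]$, not all zero, such that $a_0(x)f(x)+a_1(x)f(x^p)+\cdots+a_n(x)f(x^{p^n})=0$. Two natural numbers $p_1,p_2$ are multiplicatively independent if $p_1^{a}p_2^{b}=1$ with $a,b\in\mathbb{Z}$ implies $a=b=0$. *)

(* Defs.v *)
From Stdlib Require Rdefinitions.
From HB Require Import structures.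
From mathcomp Require Import all_boot all_order all_algebra.
From mathcomp Require Import Rstruct.
From mathcomp Require Import complex.
Set Implicit Arguments. Unset Strict Implicit. Unset Printing Implicit Defensive.
Import Order.TTheory GRing.Theory Num.Theory.
Local Open Scope ring_scope.

Definition Cplx : Type := complex Rdefinitions.R.

Definition pseries := nat -> Cplx.

Definition ps0 : pseries := fun _ => 0.
Definition ps1 : pseries := fun n => if n == 0%N then 1 else 0.

Definition ps_mul (f g : pseries) : pseries :=
  fun n => \sum_(k < n.+1) f k * g (n - k)%N.

Definition ps_add (f g : pseries) : pseries := fun n => f n + g n.

Definition ps_exp (f : pseries) (k : nat) : pseries := iter k (ps_mul f) ps1.

Definition ps_of_poly (a : {poly Cplx}) : pseries := fun n => a`_n.

Definition ps_subst_pow (f : pseries) (q : nat) : pseries :=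
  fun n => if (q %| n)%N then f (n %/ q)%N else 0.

Definition ps_sum (I : finType) (F : I -> pseries) : pseries :=
  fun n => \sum_(i : I) F i n.

Definition is_mahler (p : nat) (f : pseries) : Prop :=
  exists (n : nat) (a : 'I_n.+1 -> {poly Cplx}),
    (exists i, a i != 0) /\
    ps_sum (fun i : 'I_n.+1 => ps_mul (ps_of_poly (a i)) (ps_subst_pow f (p ^ i)))
      = ps0.

Definition is_rational (f : pseries) : Prop :=
  exists (A B : {poly Cplx}), B != 0 /\ ps_mul (ps_of_poly B) f = ps_of_poly A.

(* f, g algebraically independent over C(x): no nonzero polynomial
   P(Y,Z) = sum_{i,j<N} c_{ij} Y^i Z^j with coefficients c_{ij} in C(x)
   vanishes at (f,g).  Clearing denominators, coefficients are taken in C[x]. *)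
Definition alg_indep (f g : pseries) : Prop :=
  forall (N : nat) (c : 'I_N -> 'I_N -> {poly Cplx}),
    ps_sum (fun ij : 'I_N * 'I_N =>
      ps_mul (ps_of_poly (c ij.1 ij.2))
             (ps_mul (ps_exp f ij.1) (ps_exp g ij.2))) = ps0 ->
    forall i j, c i j = 0.

Definition mult_indep (p1 p2 : nat) : Prop :=
  forall a b : int, (p1%:Q) ^ a * (p2%:Q) ^ b = 1 -> a = 0 /\ b = 0.

(* Main.v *)
Require Import Defs.
From HB Require Import structures.
From mathcomp Require Import all_boot all_order all_algebra.
From mathcomp Require Import generic_quotient fraction cyclic separable cyclotomic.
From mathcomp Require Import boolp complex Rstruct.
From mathcomp Require Import zify ring.
Set Implicit Arguments. Unset Strict Implicit. Unset Printing Implicit Defensive.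
Import GRing.Theory Num.Theory.
Local Open Scope ring_scope.

(** In two variables [X] and [Z = y X], families [F_a(X)] and [G_b(Z)], each linearly
    independent over the rational functions, have independent products. If [F] solves a
    [p1]-Mahler system and [G] a [p2]-Mahler one, iterating both turns a relation
    [sum l_ab(x) F_a(x) G_b(x) = 0] into [sum l'_ab(x) F_a(x^P) G_b(x^P') = 0] with
    [P = p1^k], [P' = p2^l] and [deg l' = O(P + P')]. Multiplicative independence allows
    [P' = P + E] with [0 < |E| / P] as small as we please; then [X = x^P] and [y = x^E] live
    on scales so different that they act as independent variables, and [l' = 0]. Hence the
    [F_a G_b] are independent, and an algebraic relation between [f] and [g] makes one of
    them algebraic.

    An algebraic [p]-Mahler series is rational: after multiplication by a polynomial it is a
    series [g] integral over [C[x]], and all rotations [g(z x)] with [z ^ (p^k) = 1] lie in one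
    finite-dimensional algebra over [C(x)]. So do the sections of [g] modulo [p^k]; they are
    integral of bounded height, whence a bound on their orders at [0], that is, on the
    exponents occurring in [g]. *)

(** * Formal power series *)

(** Convertible with [pseries] for [R := Cplx], and the ring operations below unfold to those of the
    statement, so the final transfer is by conversion. The separate name carries the ring
    structure. *)
Definition fps (R : Type) : Type := nat -> R.

HB.instance Definition _ (R : Type) := gen_eqMixin (fps R).
HB.instance Definition _ (R : Type) := gen_choiceMixin (fps R).

Section FpsRing.
Variable R : comNzRingType.
Implicit Types (f g h : fps R) (p q : {poly R}) (n : nat).

Definition fps_zero : fps R := fun=> 0.
Definition fps_opp f : fps R := fun n => - f n.
Definition fps_plus f g : fps R := fun n => f n + g n.
Definition fps_one : fps R := fun n => if n == 0%N then 1 else 0.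
Definition fps_times f g : fps R := fun n => \sum_(k < n.+1) f k * g (n - k)%N.

(** Coefficient [n] of a product only sees coefficients up to [n]; truncating turns identities
    between series into identities between polynomials. *)
Definition fps_trunc n f : {poly R} := \poly_(i < n.+1) f i.

Lemma fps_truncE m n f i : (i <= n)%N -> (n <= m)%N -> (fps_trunc m f)`_i = f i.
Proof. by move=> le_in le_nm; rewrite coef_poly ltnS (leq_trans le_in). Qed.

Lemma fps_timesE m n f g : (n <= m)%N ->
  fps_times f g n = (fps_trunc m f * fps_trunc m g)`_n.
Proof.
move=> le_nm; rewrite coefM; apply: eq_bigr => i _.
by rewrite !(@fps_truncE m n) ?leq_subr // -ltnS.
Qed.

Fact fps_plusA : associative fps_plus.
Proof. by move=> f g h; apply/funext => n; rewrite /fps_plus addrA. Qed.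
Fact fps_plusC : commutative fps_plus.
Proof. by move=> f g; apply/funext => n; rewrite /fps_plus addrC. Qed.
Fact fps_plus0 : left_id fps_zero fps_plus.
Proof. by move=> f; apply/funext => n; rewrite /fps_plus add0r. Qed.
Fact fps_plusN : left_inverse fps_zero fps_opp fps_plus.
Proof. by move=> f; apply/funext => n; rewrite /fps_plus addNr. Qed.

HB.instance Definition _ :=
  GRing.isZmodule.Build (fps R) fps_plusA fps_plusC fps_plus0 fps_plusN.

Fact fps_timesC : commutative fps_times.
Proof.
by move=> f g; apply/funext => n; rewrite !(fps_timesE f g (leqnn n)) mulrC -fps_timesE.
Qed.

Lemma eq_coef_mul m (p q p' : {poly R}) : (forall i, (i <= m)%N -> p`_i = p'`_i) ->
  (p * q)`_m = (p' * q)`_m.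
Proof.
by move=> eq_p; rewrite !coefM; apply: eq_bigr => i _; rewrite eq_p // -ltnS.
Qed.

Fact fps_timesA : associative fps_times.
Proof.
move=> f g h; apply/funext => n.
have tr u v i : (i <= n)%N ->
    (fps_trunc n (fps_times u v))`_i = (fps_trunc n u * fps_trunc n v)`_i.
  by move=> le_in; rewrite (@fps_truncE n i) // (@fps_timesE n).
rewrite !(fps_timesE _ _ (leqnn n)) (eq_coef_mul _ (tr f g)).
by rewrite mulrC (eq_coef_mul _ (tr g h)) mulrC mulrA.
Qed.

Fact fps_times1 : left_id fps_one fps_times.
Proof.
move=> f; apply/funext => n; rewrite /fps_times big_ord_recl /= subn0 mul1r.
by rewrite big1 ?addr0 // => i _; rewrite mul0r.
Qed.

Fact fps_timesDl : left_distributive fps_times fps_plus.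
Proof.
move=> f g h; apply/funext => n; rewrite /fps_times /fps_plus -big_split /=.
by apply: eq_bigr => i _; rewrite mulrDl.
Qed.

Fact fps_one_neq0 : fps_one != 0 :> fps R.
Proof. by apply/eqP => /(congr1 (@^~ 0%N))/eqP; rewrite oner_eq0. Qed.

HB.instance Definition _ :=
  GRing.Zmodule_isComNzRing.Build (fps R)
    fps_timesA fps_timesC fps_times1 fps_timesDl fps_one_neq0.

Lemma fpsD f g n : (f + g) n = f n + g n. Proof. by []. Qed.
Lemma fpsN f n : (- f) n = - f n. Proof. by []. Qed.
Lemma fps0 n : (0 : fps R) n = 0. Proof. by []. Qed.
Lemma fps1 n : (1 : fps R) n = (n == 0%N)%:R.
Proof. by rewrite -[LHS]/(if n == 0%N then 1 else 0); case: eqP. Qed.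
Lemma fpsM f g n : (f * g) n = \sum_(k < n.+1) f k * g (n - k)%N.
Proof. by []. Qed.
Lemma fps_sum (I : Type) (r : seq I) (P : pred I) (F : I -> fps R) n :
  (\sum_(i <- r | P i) F i) n = \sum_(i <- r | P i) F i n.
Proof. by elim/big_rec2: _ => //= i y z _ <-; rewrite fpsD. Qed.

Definition fpoly p : fps R := fun n => p`_n.

Lemma fpolyE p n : fpoly p n = p`_n. Proof. by []. Qed.

Fact fpoly_zmod : zmod_morphism fpoly.
Proof. by move=> p q; apply/funext => n; rewrite /fpoly coefB. Qed.
HB.instance Definition _ := GRing.isZmodMorphism.Build _ _ fpoly fpoly_zmod.

Fact fpoly_monoid : monoid_morphism fpoly.
Proof.
split; first by apply/funext => n; rewrite /fpoly coef1 fps1.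
by move=> p q; apply/funext => n; rewrite /fpoly coefM.
Qed.
HB.instance Definition _ := GRing.isMonoidMorphism.Build _ _ fpoly fpoly_monoid.

Lemma fpoly_inj : injective fpoly.
Proof. by move=> p q eq_pq; apply/polyP => n; rewrite -!fpolyE eq_pq. Qed.

Lemma fpoly_eq0 p : (fpoly p == 0) = (p == 0).
Proof. by rewrite -(inj_eq fpoly_inj) rmorph0. Qed.

Lemma fps_mul_trunc m n f g : (n <= m)%N ->
  (f * g) n = (fps_trunc m f * fps_trunc m g)`_n.
Proof. exact: fps_timesE. Qed.

Definition fps_subst (q : nat) f : fps R :=
  fun n => if (q %| n)%N then f (n %/ q)%N else 0.

Definition fps_rot (z : R) f : fps R := fun n => z ^+ n * f n.

Fact fps_rot_zmod z : zmod_morphism (fps_rot z).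
Proof.
by move=> f g; apply/funext => n; rewrite /fps_rot fpsD fpsN mulrDr mulrN.
Qed.
HB.instance Definition _ z := GRing.isZmodMorphism.Build _ _ (fps_rot z) (fps_rot_zmod z).

Fact fps_rot_monoid z : monoid_morphism (fps_rot z).
Proof.
split.
  by apply/funext => -[|n]; rewrite /fps_rot fps1 ?expr0 ?mulr1 ?mulr0.
move=> f g; apply/funext => n; rewrite /fps_rot !fpsM mulr_sumr.
apply: eq_bigr => i _; rewrite -{1}(@subnKC i n) -1?ltnS // exprD; ring.
Qed.
HB.instance Definition _ z :=
  GRing.isMonoidMorphism.Build _ _ (fps_rot z) (fps_rot_monoid z).

Lemma fps_rot_poly z p : fps_rot z (fpoly p) = fpoly (p \Po (z *: 'X)).
Proof.
apply/funext => n; rewrite /fps_rot !fpolyE comp_polyE.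
under eq_bigr => i _ do rewrite exprZn scalerA.
rewrite -(poly_def _ (fun i => p`_i * z ^+ i)) coef_poly.
case: ltnP => [_|le_pn]; first by rewrite mulrC.
by rewrite nth_default ?mulr0.
Qed.

Section Subst.
Variable q : nat.
Hypothesis q_gt0 : (0 < q)%N.

Lemma fps_subst_poly p : fps_subst q (fpoly p) = fpoly (p \Po 'X^q).
Proof. by apply/funext => n; rewrite /fps_subst !fpolyE coef_comp_poly_Xn. Qed.

Lemma fps_subst_trunc n m f : (n <= m)%N ->
  fps_subst q f n = (fps_trunc m f \Po 'X^q)`_n.
Proof.
move=> le_nm; rewrite coef_comp_poly_Xn // /fps_subst; case: ifP => // _.
by rewrite (@fps_truncE m (n %/ q)) // (leq_trans (leq_div _ _)).
Qed.

Lemma fps_substM f g : fps_subst q (f * g) = fps_subst q f * fps_subst q g.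
Proof.
apply/funext => n; rewrite (@fps_subst_trunc n n) //.
rewrite (@fps_mul_trunc n n) //.
have tr u i : (i <= n)%N -> (fps_trunc n (fps_subst q u))`_i = (fps_trunc n u \Po 'X^q)`_i.
  by move=> le_in; rewrite (@fps_truncE n i) // (@fps_subst_trunc i n).
rewrite (eq_coef_mul _ (tr f)) [in RHS]mulrC (eq_coef_mul _ (tr g)) [in RHS]mulrC.
rewrite -comp_polyM.
rewrite !coef_comp_poly_Xn //; case: ifP => // _.
have le_n : (n %/ q <= n)%N by apply: leq_div.
by rewrite (@fps_truncE n (n %/ q)) // (@fps_mul_trunc n).
Qed.

Lemma fps_subst1 : fps_subst q 1 = 1.
Proof. by rewrite -(rmorph1 fpoly) fps_subst_poly comp_polyC. Qed.

End Subst.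

Lemma fps_subst_id f : fps_subst 1 f = f.
Proof. by apply/funext => n; rewrite /fps_subst dvd1n divn1. Qed.

Lemma fps_subst_comp a b f : (0 < a)%N ->
  fps_subst a (fps_subst b f) = fps_subst (a * b) f.
Proof.
move=> a_gt0; apply/funext => n; rewrite /fps_subst mulnC.
have [/dvdnP[m ->]|aNn] := boolP (a %| n)%N; last first.
  by case: ifP => // /(dvdn_trans (dvdn_mull b (dvdnn a))); rewrite (negPf aNn).
by rewrite mulnK // dvdn_pmul2r // divnMr.
Qed.

End FpsRing.

(** * Linear algebra over an integral domain *)

Lemma ltmx_ker_rank (F : fieldType) m n p (A : 'M[F]_(m, n)) (B : 'M[F]_(m, p)) :
  (kermx B < kermx A)%MS -> (\rank A < \rank B)%N.
Proof.
move=> /rank_ltmx; rewrite !mxrank_ker.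
by move: (rank_leq_row A) (rank_leq_row B) (\rank A) (\rank B) => + + a b; lia.
Qed.

Section ClearDenominators.
Variable R : idomainType.
Local Notation "x %:F" := (@FracField.tofrac R x).

Lemma frac_num_den (x : {fraction R}) : exists n d, d != 0 /\ d%:F * x = n%:F.
Proof.
elim/quotW: x => x; exists \n_x, \d_x; split; first exact: denom_ratioP.
unlock FracField.tofrac.
rewrite -[LHS]FracField.pi_mul; apply/eqmodP => /=.
rewrite FracField.equivfE /FracField.mulf.
by rewrite !numden_Ratio ?oner_neq0 ?mul1r ?mulr1 ?denom_ratioP //.
Qed.

Lemma common_denominator (I : finType) (x : I -> {fraction R}) :
  exists d (n : I -> R), d != 0 /\ forall i, d%:F * x i = (n i)%:F.
Proof.
have [n nP] := choice (fun i => frac_num_den (x i)).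
have [d dP] := choice nP.
exists (\prod_i d i), (fun i => n i * \prod_(j | j != i) d j); split.
  by apply/prodf_neq0 => i _; case: (dP i).
move=> i; rewrite (bigD1 i) //= [in RHS]tofracM -(dP i).2 tofracM; ring.
Qed.

Lemma not_row_free_ker m n (A : 'M[{fraction R}]_(m, n)) : ~~ row_free A ->
  exists v : 'I_m -> R, (exists i, v i != 0) /\
    forall j, \sum_i (v i)%:F * A i j = 0.
Proof.
rewrite -kermx_eq0 => /rowV0Pn[u /sub_kermxP uA u_neq0].
have [d [v [d_neq0 vP]]] := common_denominator (fun i => u 0 i).
exists v; split=> [|j].
  case/rV0Pn: u_neq0 => i ui; exists i.
  by rewrite -tofrac_eq0 -vP mulf_neq0 ?tofrac_eq0.
under eq_bigr => i _ do rewrite -vP -mulrA.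
by rewrite -mulr_sumr; move/matrixP/(_ 0 j): uA; rewrite !mxE => ->; rewrite mulr0.
Qed.

(** More unknowns than equations: the rank over the fraction field is too small, and clearing
    denominators brings a kernel vector back to [R]. It serves both for polynomials and for
    constants. *)
Lemma kernel_vector (I J : finType) (M : I -> J -> R) : (#|J| < #|I|)%N ->
  exists v : I -> R, (exists i, v i != 0) /\ forall j, \sum_i v i * M i j = 0.
Proof.
move=> lt_JI; pose A := \matrix_(i < #|I|, j < #|J|) (M (enum_val i) (enum_val j))%:F.
have [|v [[i vi] vA]] := @not_row_free_ker _ _ A.
  by rewrite /row_free neq_ltn (leq_ltn_trans (rank_leq_col A)).
exists (fun i => v (enum_rank i)); split=> [|j].
  by exists (enum_val i); rewrite enum_valK.
apply/eqP; rewrite -tofrac_eq0 rmorph_sum /= (reindex (@enum_val I I)) /=; last first.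
  by apply: onW_bij; apply: enum_val_bij.
apply/eqP; rewrite -[RHS](vA (enum_rank j)); apply: eq_bigr => k _.
by rewrite mxE enum_rankK enum_valK tofracM.
Qed.

(** Finitely many rows of [Phi] already have full rank; a one-sided inverse of that block, cleared
    of its common denominator [D], is [Psi]. It later isolates one unknown from a system of
    relations. *)
Lemma left_inverse_up_to_scalar (I : finType) (Phi : nat -> I -> R) :
  (forall k : I -> R, (forall s, \sum_i k i * Phi s i = 0) -> forall i, k i = 0) ->
  exists S (D : R) (Psi : I -> 'I_S -> R), D != 0 /\
    forall i j, \sum_s Psi i s * Phi s j = D *+ (i == j).
Proof.
move=> indep; pose W S := \matrix_(i < #|I|, s < S) (Phi s (enum_val i))%:F.
have [S W_free] : exists S, row_free (W S).
  (* Induction on the rank: while it is below [#|I|], some vector kills the first [S] rows of [Phi],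
     independence provides a row [s] that it does not kill, and adjoining that row shrinks the
     kernel. *)
  suff /(_ #|I|)[//|S leS]: forall r, (r <= #|I|)%N -> exists S, (r <= \rank (W S))%N.
    by exists S; rewrite -row_leq_rank.
  elim=> [_|r IHr lt_r]; first by exists 0%N.
  have [S leS] := IHr (ltnW lt_r); have [ltS|geS] := ltnP r (\rank (W S)); first by exists S.
  have [|v [[i vi] vW]] := @not_row_free_ker _ _ (W S).
    by rewrite /row_free neq_ltn (leq_ltn_trans geS).
  have [s vs] : exists s, \sum_i v (enum_rank i) * Phi s i <> 0.
    apply/existsNP => v0; move/eqP: vi; case.
    by rewrite -(indep _ v0 (enum_val i)) enum_valK.
  exists (maxn S s.+1); set S' := maxn _ _.
  rewrite (leq_ltn_trans leS) //; apply: ltmx_ker_rank.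
  have leSS' : (S <= S')%N by rewrite leq_maxl.
  have ltsS' : (s < S')%N by rewrite leq_maxr.
  apply/andP; split.
    apply/row_subP => k; apply/sub_kermxP/rowP => t.
    have /sub_kermxP/rowP/(_ (widen_ord leSS' t)) := row_sub k (kermx (W S')).
    by rewrite !mxE => {2}<-; apply: eq_bigr => l _; rewrite !mxE.
  apply/negP => sub; pose u := \row_i (v i)%:F.
  have/(submx_trans)/(_ sub) : (u <= kermx (W S))%MS.
    apply/sub_kermxP/rowP => t; rewrite !mxE -[RHS](vW t).
    by apply: eq_bigr => l _; rewrite !mxE.
  move/sub_kermxP/rowP/(_ (Ordinal ltsS')); rewrite !mxE => uW; case: vs.
  apply/eqP; rewrite -tofrac_eq0 rmorph_sum /= (reindex (@enum_val I I)) /=; last first.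
    by apply: onW_bij; apply: enum_val_bij.
  apply/eqP; rewrite -[RHS]uW; apply: eq_bigr => l _.
  by rewrite !mxE enum_valK tofracM.
have [d [n [d_neq0 nP]]] :=
  common_denominator (fun si : 'I_S * 'I_#|I| => pinvmx (W S) si.1 si.2).
exists S, d, (fun i s => n (s, enum_rank i)); split=> // i j.
apply/eqP; rewrite -tofrac_eq rmorph_sum rmorphMn /=; apply/eqP.
under eq_bigr => s _ do rewrite tofracM -nP /= -mulrA.
rewrite -mulr_sumr; move/mulmxVp/matrixP/(_ (enum_rank j) (enum_rank i)): W_free.
rewrite !mxE (inj_eq enum_rank_inj) eq_sym -mulr_natr => <-; congr (_ * _).
by apply: eq_bigr => s _; rewrite !mxE enum_rankK mulrC.
Qed.

End ClearDenominators.

(** * Dependence over the polynomials *)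

Section Span.
Variable K : fieldType.
Implicit Types (I J : finType) (f g h : fps K) (d : {poly K}).

Lemma fps_order f : f <> 0 -> exists2 n, f n != 0 & forall i, (i < n)%N -> f i = 0.
Proof.
move=> f_neq0; have ex_n : exists n, f n != 0.
  apply: contrapT => /forallNP f0; apply: f_neq0; apply/funext => n.
  by apply/eqP; apply/negPn/negP/f0.
case: (ex_minnP ex_n) => n fn minn; exists n => // i lt_in.
by apply/eqP; apply/negPn/negP => /minn; rewrite leqNgt lt_in.
Qed.

Lemma fps_mul_low m n f g :
    (forall i, (i < m)%N -> f i = 0) -> (forall i, (i < n)%N -> g i = 0) ->
  (forall i, (i < m + n)%N -> (f * g) i = 0) /\ (f * g) (m + n)%N = f m * g n.
Proof.
move=> f0 g0; split=> [i lt_i|]; rewrite fpsM.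
  apply: big1 => j _; have [/f0->|le_mj] := ltnP j m; first by rewrite mul0r.
  by rewrite [g _]g0 ?mulr0 //; case: j le_mj => j /= ltj; lia.
have lt_m : (m < (m + n).+1)%N by rewrite ltnS leq_addr.
rewrite (bigD1 (Ordinal lt_m)) //= addKn big1 ?addr0 // => j.
rewrite -val_eqE /= => neq_jm; have [/f0->|le_mj] := ltnP j m; first by rewrite mul0r.
by rewrite [g _]g0 ?mulr0 //; case: j le_mj neq_jm => j /= ltj; lia.
Qed.

Lemma fps_mul_eq0 f g : f * g = 0 -> f = 0 \/ g = 0.
Proof.
move=> fg0; have [->|/fps_order[m fm f0]] := pselect (f = 0); first by left.
have [->|/fps_order[n gn g0]] := pselect (g = 0); first by right.
have [_ ] := fps_mul_low f0 g0; rewrite fg0 fps0 => /esym/eqP.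
by rewrite mulf_eq0 (negPf fm) (negPf gn).
Qed.

Lemma fpoly_mulI d f g : d != 0 -> fpoly d * f = fpoly d * g -> f = g.
Proof.
move=> d_neq0 /eqP; rewrite -subr_eq0 -mulrBr => /eqP/fps_mul_eq0[/eqP|/eqP].
  by rewrite fpoly_eq0 (negPf d_neq0).
by rewrite subr_eq0 => /eqP.
Qed.

(** Independence over [K(x)] with denominators cleared; likewise the factor [d] in [in_span] is a
    common denominator. *)
Definition free_family I (F : I -> fps K) :=
  forall nu : I -> {poly K}, \sum_i fpoly (nu i) * F i = 0 -> forall i, nu i = 0.

Definition in_span I (F : I -> fps K) h :=
  exists d (nu : I -> {poly K}), d != 0 /\ fpoly d * h = \sum_i fpoly (nu i) * F i.

Lemma in_span_gen I (F : I -> fps K) i : in_span F (F i).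
Proof.
exists 1, (fun j => (j == i)%:R); split; first exact: oner_neq0.
rewrite (bigD1 i) //= big1 ?addr0 ?eqxx // => j /negPf->.
by rewrite rmorph0 mul0r.
Qed.

Lemma in_span_common I J (F : I -> fps K) (h : J -> fps K) :
    (forall j, in_span F (h j)) ->
  exists d (nu : J -> I -> {poly K}),
    d != 0 /\ forall j, fpoly d * h j = \sum_i fpoly (nu j i) * F i.
Proof.
move=> spanh; have [d dP] := choice spanh; have [nu nuP] := choice dP.
exists (\prod_j d j), (fun j i => (\prod_(k | k != j) d k) * nu j i); split.
  by apply/prodf_neq0 => j _; case: (nuP j).
move=> j; rewrite (bigD1 j) //= mulrC rmorphM /= mulrA.
rewrite (mulrC (h j)) (nuP j).2 mulr_suml; apply: eq_bigr => i _.
by rewrite rmorphM /=; ring.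
Qed.

Lemma in_span_trans I J (F : I -> fps K) (G : J -> fps K) h :
  (forall j, in_span F (G j)) -> in_span G h -> in_span F h.
Proof.
move=> /in_span_common[d [nu [d_neq0 nuP]]] [e [mu [e_neq0 muP]]].
exists (d * e), (fun i => \sum_j mu j * nu j i); split; first by rewrite mulf_neq0.
transitivity (\sum_j \sum_i fpoly (mu j * nu j i) * F i).
  rewrite rmorphM -mulrA muP mulr_sumr; apply: eq_bigr => j _.
  by rewrite mulrCA nuP mulr_sumr; apply: eq_bigr => i _; rewrite rmorphM mulrA.
rewrite exchange_big; apply: eq_bigr => i _.
by rewrite rmorph_sum mulr_suml.
Qed.

Lemma in_span_dependent I J (F : I -> fps K) (h : J -> fps K) :
    (forall j, in_span F (h j)) -> (#|I| < #|J|)%N -> 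
  exists v : J -> {poly K}, (exists j, v j != 0) /\ \sum_j fpoly (v j) * h j = 0.
Proof.
move=> /in_span_common[d [nu [d_neq0 nuP]]] /(kernel_vector nu)[v [vj vP]].
exists v; split=> //; apply: (fpoly_mulI d_neq0).
rewrite mulr0 mulr_sumr; under eq_bigr => j _ do rewrite mulrCA nuP mulr_sumr.
rewrite exchange_big big1 // => i _.
under eq_bigr => j _ do rewrite mulrA -rmorphM.
by rewrite -mulr_suml -rmorph_sum /= vP rmorph0 mul0r.
Qed.

Lemma big_option (V : nmodType) I (F : option I -> V) :
  \sum_o F o = F None + \sum_i F (Some i).
Proof.
rewrite (bigD1 None) //= (reindex_omap Some id) /=; last by case.
by congr (_ + _); apply: eq_bigl => i; rewrite eqxx.
Qed.

(** Exchange argument: adjoining [h] to [G] gives more than [#|I|] vectors in the span of [F], hence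
    a relation, whose coefficient at [h] is nonzero because [G] is free. *)
Lemma free_in_span_basis I J (F : I -> fps K) (G : J -> fps K) :
    free_family G -> (#|I| <= #|J|)%N -> (forall j, in_span F (G j)) ->
  forall h, in_span F h -> in_span G h.
Proof.
move=> freeG leIJ FG h Fh.
pose H (o : option J) := if o is Some j then G j else h.
have [||v [[o vo] vH]] := @in_span_dependent _ _ F H; first by case.
  by rewrite card_option ltnS.
have vN : v None != 0.
  apply: contraNneq vo => vN; apply/eqP; case: o => [j|//].
  apply: (freeG (fun j => v (Some j))); rewrite -[RHS]vH.
  by rewrite big_option /= vN rmorph0 mul0r add0r.
exists (v None), (fun j => - v (Some j)); split=> //.
move/eqP: vH; rewrite big_option /= addr_eq0 => /eqP->.
by rewrite -sumrN; apply: eq_bigr => j _; rewrite rmorphN mulNr.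
Qed.

(** Take a free set of indices of maximal cardinality: adjoining any other index creates a relation
    that can be solved for it. *)
Lemma max_free_subfamily J (h : J -> fps K) :
  exists r (e : 'I_r -> J), free_family (h \o e) /\ forall j, in_span (h \o e) (h j).
Proof.
pose freeset (A : {set J}) := forall nu : J -> {poly K},
  \sum_(j in A) fpoly (nu j) * h j = 0 -> forall j, j \in A -> nu j = 0.
have free0 : `[< freeset set0 >] by apply/asboolP => nu _ j; rewrite inE.
have [A /asboolP freeA maxA] := @arg_maxnP _ set0 (fun A => `[< freeset A >]) (fun A => #|A|) free0.
exists #|A|, enum_val; split=> [nu nu0 i|j].

  pose mu (j : J) := nu (enum_rank_in (enum_valP i) j).
  have := freeA mu _ (enum_val i) (enum_valP i); rewrite /mu enum_valK_in; apply.
  rewrite -[RHS]nu0 big_enum_val /=.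
  by apply: eq_bigr => k _; rewrite enum_valK_in.
have [jA|jA] := boolP (j \in A).
  by rewrite -(enum_rankK_in jA jA); apply: (in_span_gen (h \o enum_val)).
have : ~ freeset (j |: A).
  move=> freejA; have /maxA := introT (asboolP _) freejA.
  by rewrite /geq /= cardsU1 jA add1n ltnn.
move=> /existsNP[nu /not_implyP[nu0 /existsNP[k /not_implyP[kjA /eqP nuk]]]].
move: nu0; rewrite big_setU1 //= => nu0.
have nuj : nu j != 0.
  apply: contraNneq nuk => nuj; move: nu0 kjA; rewrite nuj rmorph0 mul0r add0r.
  by rewrite in_setU1 => /freeA freeAk /orP[/eqP->|/freeAk->] //; rewrite nuj.
exists (nu j), (fun i => - nu (enum_val i)); split=> //.
move/eqP: nu0; rewrite addr_eq0 => /eqP->; rewrite big_enum_val /=.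
by rewrite -sumrN; apply: eq_bigr => i _; rewrite rmorphN mulNr.
Qed.

End Span.

(** * Separation of variables *)

Section Separate.
Variable K : fieldType.

Lemma fps_mul_eq_upto n (f f' g g' : fps K) :
    (forall i, (i <= n)%N -> f i = f' i) -> (forall i, (i <= n)%N -> g i = g' i) ->
  forall i, (i <= n)%N -> (f * g) i = (f' * g') i.
Proof.
move=> ff gg i le_in; rewrite !fpsM; apply: eq_bigr => j _.
by rewrite ff ?gg // (leq_trans _ le_in) ?leq_subr // -ltnS.
Qed.

Lemma fpoly_XnM c (f : fps K) n :
  (fpoly 'X^c * f) n = if (n < c)%N then 0 else f (n - c)%N.
Proof.
rewrite (fps_mul_trunc _ _ (leqnn n)) (@eq_coef_mul _ _ _ _ 'X^c); last first.
  by move=> i le_in; rewrite (fps_truncE _ le_in).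
by rewrite coefXnM; case: ltnP => // _; rewrite (@fps_truncE _ _ (n - c)) ?leq_subr.
Qed.

Lemma fpolyC_M a (f : fps K) n : (fpoly a%:P * f) n = a * f n.
Proof.
rewrite fpsM big_ord_recl /= subn0 fpolyE coefC eqxx big1 ?addr0 // => i _.
by rewrite fpolyE coefC mul0r.
Qed.

Lemma fpoly_ZXnM a c (f : fps K) n :
  (fpoly (a *: 'X^c) * f) n = a * (if (n < c)%N then 0 else f (n - c)%N).
Proof. by rewrite -mul_polyC rmorphM -mulrA fpolyC_M fpoly_XnM. Qed.

Lemma comp_Xn_sum n (p : {poly K}) q : (size p <= n)%N ->
  p \Po 'X^q = \sum_(m < n) p`_m *: 'X^(q * m).
Proof.
move=> le_pn; rewrite comp_polyE (big_ord_widen n (fun i => p`_i *: 'X^q ^+ i)) //.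
rewrite big_mkcond; apply: eq_bigr => i _; rewrite exprM.
by case: ltnP => // le_pi; rewrite nth_default ?scale0r.
Qed.

Lemma coef_comp_XnM n (p l : {poly K}) q k : (size p <= n)%N ->
  ((p \Po 'X^q) * l)`_k =
  \sum_(m < n) p`_m * (if (k < q * m)%N then 0 else l`_(k - q * m)).
Proof.
move=> le_pn; rewrite (comp_Xn_sum _ le_pn) mulr_suml coef_sum.
by apply: eq_bigr => m _; rewrite -scalerAl coefZ coefXnM.
Qed.

Lemma coef_two_scale (l : {poly K}) (f g : fps K) P Q n : (0 < P)%N -> (0 < Q)%N ->
  (fpoly l * (fps_subst P f * fps_subst Q g)) n =
  \sum_(m' < n.+1) g m' * \sum_(m < n.+1) f m *
    (if (n < P * m + Q * m')%N then 0 else l`_(n - (P * m + Q * m'))).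
Proof.
move=> P_gt0 Q_gt0; set f' := fps_trunc n f; set g' := fps_trunc n g.
have trE (u : fps K) q (q_gt0 : (0 < q)%N) i : (i <= n)%N ->
    fps_subst q u i = fpoly (fps_trunc n u \Po 'X^q) i.
  by move=> le_in; rewrite (fps_subst_trunc q_gt0 _ le_in).
rewrite (@fps_mul_eq_upto n _ (fpoly l) _ (fpoly ((g' \Po 'X^Q) * (f' \Po 'X^P)))) //; last first.
  move=> i le_in; rewrite rmorphM mulrC /=.
  by apply: fps_mul_eq_upto le_in => j le_jn; rewrite trE.
rewrite -rmorphM /= fpolyE [l * _]mulrC -mulrA.
rewrite (@coef_comp_XnM n.+1) ?size_poly //; apply: eq_bigr => m' _.
rewrite (@fps_truncE _ n n _ _ (ltn_ord m')) //; congr (_ * _).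
rewrite (@coef_comp_XnM n.+1) ?size_poly //.
case: ltnP => [lt_n|le_n].
  rewrite big1 // => m _; case: ltnP => [_|]; rewrite ?mulr0 //; lia.
apply: eq_bigr => m _; rewrite (@fps_truncE _ n n _ _ (ltn_ord m)) //; congr (_ * _).
rewrite (_ : (n - Q * m' < P * m)%N = (n < P * m + Q * m')%N); last by lia.
by case: ifP => // _; congr (l`_ _); lia.
Qed.

Variables (I J : finType) (F : I -> fps K) (G : J -> fps K).
Hypotheses (freeF : free_family F) (freeG : free_family G).

Section Separation.
Variable C : nat.
Let idx := (I * J * 'I_C)%type.

(* The coefficient of X^s in X^c F_a(X) G_b(yX), a polynomial in y. *)
Definition sep_coef (s : nat) (i : idx) : {poly K} :=
  if (i.2 <= s)%N then \poly_(m < (s - i.2).+1) (F i.1.1 (s - i.2 - m)%N * G i.1.2 m) else 0.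

Lemma coef_sep_coef s (i : idx) m : (sep_coef s i)`_m =
  if (i.2 + m <= s)%N then F i.1.1 (s - i.2 - m)%N * G i.1.2 m else 0.
Proof.
rewrite /sep_coef; case: leqP => [le_is|lt_si]; last first.
  by rewrite coef0 leqNgt (leq_trans lt_si) ?leq_addr.
by rewrite coef_poly ltnS leq_subRL.
Qed.

Lemma size_sep_coef s i : (size (sep_coef s i) <= s.+1)%N.
Proof.
rewrite /sep_coef; case: ifP => _; last by rewrite size_poly0.
by rewrite (leq_trans (size_poly _ _)) // ltnS leq_subr.
Qed.

(* Substituting Z = yX turns F_a(X) G_b(yX) into a product of series in independent variables. *)
Lemma sep_coef_independent (k : idx -> {poly K}) :
  (forall s, \sum_i k i * sep_coef s i = 0) -> forall i, k i = 0.
Proof.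
move=> k0; pose M := (\max_i size (k i))%N.
have sizek i : (size (k i) <= M)%N by apply: leq_bigmax.
(* [Fz a u v] is coefficient [u - v] of [F a], zero for negative exponents. As y = Z / X, powers of
   X may be negative; the offset [M] keeps the indices natural. *)
pose Fz a u v : K := if (v <= u)%N then F a (u - v)%N else 0.
pose c n b e := \sum_a \sum_(t < C) (k (a, b, t))`_e * Fz a (n + e)%N (t + M)%N.
pose r n b := \poly_(e < M) c n b e.
have cM n b e : (M <= e)%N -> c n b e = 0.
  move=> le_Me; rewrite /c big1 // => a _; rewrite big1 // => t _.
  by rewrite nth_default ?mul0r // (leq_trans (sizek _)).
(* Fix the exponent [n - M] of X: what remains is a relation among the [G b] in the variable Z. *)
have r0 n : forall b, r n b = 0.
  apply: freeG; apply/funext => j; rewrite fps0 fps_sum.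
  transitivity (\sum_b \sum_(e < j.+1) \sum_a \sum_(t < C)
      (k (a, b, t))`_e * (Fz a (n + e)%N (t + M)%N * G b (j - e)%N)).
    apply: eq_bigr => b _; rewrite fpsM; apply: eq_bigr => e _; rewrite fpolyE coef_poly.
    transitivity (c n b e * G b (j - e)%N).
      by case: ltnP => // /cM->.
    rewrite /c mulr_suml; apply: eq_bigr => a _.
    by rewrite mulr_suml; apply: eq_bigr => t _; rewrite mulrA.
  have [lt_nj|le_nj] := ltnP (n + j) M.
    apply: big1 => b _; apply: big1 => e _; apply: big1 => a _; apply: big1 => t _.
    by rewrite /Fz; case: leqP => [|_]; [case: e => e /=; lia | rewrite mul0r mulr0].
  have := congr1 (fun p : {poly K} => p`_j) (k0 (n + j - M)%N).
  rewrite coef0 coef_sum; apply: etrans.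
  transitivity (\sum_b \sum_a \sum_(t < C) \sum_(e < j.+1)
      (k (a, b, t))`_e * (Fz a (n + e)%N (t + M)%N * G b (j - e)%N)).
    apply: eq_bigr => b _; rewrite exchange_big; apply: eq_bigr => a _.
    exact: exchange_big.
  rewrite exchange_big /= pair_big /= pair_big /=; apply: eq_bigr => -[[a b] t] _ /=.
  rewrite coefM; apply: eq_bigr => e _; rewrite coef_sep_coef /= /Fz.
  have lt_ej := ltn_ord e.
  rewrite (_ : (t + (j - e) <= n + j - M)%N = (t + M <= n + e)%N); last by lia.
  case: ifP => le_t; rewrite ?mul0r ?mulr0 //; congr (_ * (F a _ * _)); lia.
move=> [[a b] t]; apply/polyP => e; rewrite coef0.
have [lt_eM|le_Me] := ltnP e M; last by rewrite nth_default // (leq_trans (sizek _)).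
pose q a := \sum_(t < C) (k (a, b, t))`_e *: 'X^t : {poly K}.
(* Fix [b] and the power [e], and let [n] vary: this is a relation among the [F a] in the variable
   X. *)
have q0 : forall a, q a = 0.
  apply: freeF; apply/funext => n; rewrite fps0 fps_sum.
  have /(congr1 (fun p : {poly K} => p`_e)) := r0 (n + M - e)%N b.
  rewrite coef_poly lt_eM coef0; apply: etrans; apply: eq_bigr => a' _.
  rewrite /q rmorph_sum mulr_suml fps_sum; apply: eq_bigr => t' _ /=.
  rewrite fpoly_ZXnM /Fz; congr (_ * _).
  rewrite (_ : (t' + M <= n + M - e + e)%N = (t' <= n)%N); last by lia.
  by case: leqP => // le_tn; congr (F a' _); lia.
have := congr1 (fun p : {poly K} => p`_t) (q0 a); rewrite coef0 coef_sumMXn /=; apply: etrans.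
by rewrite (big_pred1 t) // => t'; rewrite -val_eqE eq_sym.
Qed.

End Separation.
End Separate.

(** * Relations between series at the two scales P and P + E *)

Section TwoScales.
Variables (K : fieldType) (I J : finType) (F : I -> fps K) (G : J -> fps K).
Hypotheses (freeF : free_family F) (freeG : free_family G).

Lemma big_ord_cut (V : nmodType) A B (h : nat -> V) :
  (forall i, (B <= i)%N -> h i = 0) ->
  \sum_(i < A) h i = \sum_(i < B) (if (i < A)%N then h i else 0).
Proof.
move=> h0; rewrite -big_mkcond.
rewrite (big_ord_widen (maxn A B) h) ?leq_maxl //.
rewrite [RHS](big_ord_widen_cond (maxn A B) (fun i => (i < A)%N) h) ?leq_maxr //.
rewrite [LHS]big_mkcond [RHS]big_mkcond; apply: eq_bigr => i _ /=.
by case: ltnP => //= _; case: ltnP => // /h0.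
Qed.

Variable C : nat.
Let idx := (I * J * 'I_C)%type.

Variables (P E : nat) (l : I -> J -> {poly K}).
Hypotheses (P_gt0 : (0 < P)%N) (E_gt0 : (0 < E)%N).
Hypothesis size_l : forall a b, (size (l a b) <= C * P)%N.
Hypothesis rel_l :
  \sum_a \sum_b fpoly (l a b) * (fps_subst P (F a) * fps_subst (P + E) (G b)) = 0.

(* The digits of [l a b] in base [X = x ^ P]. *)
Let digit (i : idx) : {poly K} := \poly_(r < P) (l i.1.1 i.1.2)`_(i.2 * P + r).

Lemma coef_digit (i : idx) r : (r < P)%N -> (digit i)`_r = (l i.1.1 i.1.2)`_(i.2 * P + r).
Proof. by move=> lt_rP; rewrite coef_poly lt_rP. Qed.

(** Compare the coefficients of x^(s P + r). Terms beyond X^s are too large, and for [m <= s] the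
    shift [E * m] is at most [r < P], so nothing is borrowed between base-[P] digits and the
    exponents of X can be matched alone. *)
Lemma digit_relation s r : (s * E <= r)%N -> (r < P)%N ->
  (\sum_(i : idx) (sep_coef F G s i \Po 'X^E) * digit i)`_r = 0.
Proof.
move=> le_r lt_rP; pose n := (s * P + r)%N.
have := congr1 (fun u : fps K => u n) rel_l; rewrite fps0; apply: etrans.
rewrite fps_sum coef_sum; under [RHS]eq_bigr => a _ do rewrite fps_sum.
pose term a b c m := (if (c + m <= s)%N then F a (s - c - m)%N * G b m else 0) *
  (l a b)`_(c * P + (r - E * m)).
transitivity (\sum_a \sum_b \sum_(c < C) \sum_(m < s.+1) term a b c m).
  rewrite pair_big /= pair_big /=; apply: eq_bigr => -[[a b] c] _ /=.
  rewrite (@coef_comp_XnM _ s.+1) ?size_sep_coef //; apply: eq_bigr => m _.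
  have le_Em : (E * m <= r)%N.
    by rewrite (leq_trans _ le_r) // mulnC leq_mul2r -ltnS ltn_ord orbT.
  rewrite coef_sep_coef ltnNge le_Em /= coef_digit //.
  by rewrite (leq_ltn_trans (leq_subr _ _)).
apply: eq_bigr => a _; apply: eq_bigr => b _.
rewrite coef_two_scale ?addn_gt0 ?P_gt0 // exchange_big /=.
have le_sn : (s <= n)%N by rewrite /n; nia.
rewrite [RHS](@big_ord_cut _ _ s.+1 (fun m' => G b m' * \sum_(m < n.+1) F a m *
    (if (n < P * m + (P + E) * m')%N then 0
     else (l a b)`_(n - (P * m + (P + E) * m'))))); last first.
  move=> m' lt_sm; rewrite big1 ?mulr0 // => m _.
  by rewrite (_ : (n < _)%N) ?mulr0 // /n; nia.
apply: eq_bigr => m _; have le_ms : (m <= s)%N by rewrite -ltnS.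
have le_Em : (E * m <= r)%N by rewrite (leq_trans _ le_r) // mulnC leq_mul2r le_ms orbT.
rewrite (leq_ltn_trans le_ms) ?ltnS //.
pose k c := if (c <= s - m)%N then F a (s - m - c)%N * (l a b)`_(c * P + (r - E * m)) else 0.
rewrite [in RHS](@big_ord_cut _ _ (s - m).+1 (fun m0 => F a m0 *
    (if (n < P * m0 + (P + E) * m)%N then 0
     else (l a b)`_(n - (P * m0 + (P + E) * m))))); last first.
  by move=> m0 lt_m0; rewrite (_ : (n < _)%N) ?mulr0 // /n; nia.
(* After this reversal [c] is the digit number in [l a b], and [F a] is taken at [s - m - c]. *)
rewrite [in RHS](reindex_inj rev_ord_inj) /=.
transitivity (G b m * \sum_(c < C) k c).
  rewrite mulr_sumr; apply: eq_bigr => c _; rewrite /term /k.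
  rewrite (_ : (c + m <= s)%N = (c <= s - m)%N); last by lia.
  by case: leqP => // _; rewrite ?mul0r ?mulr0 // subnAC mulrAC mulrC.
congr (_ * _); rewrite (@big_ord_cut _ _ (s - m).+1 k); last first.
  by move=> c lt_c; rewrite /k leqNgt lt_c.
apply: eq_bigr => c _; have le_c : (c <= s - m)%N by rewrite -ltnS.
rewrite /k le_c subSS (_ : (s - m - c < n.+1)%N); last by lia.
have nE : n = (P * (s - m - c) + (P + E) * m + (c * P + (r - E * m)))%N by rewrite /n; nia.
rewrite [in RHS]nE [in RHS]ltnNge leq_addr /= addKn.
case: ltnP => // le_Cc; rewrite nth_default ?mulr0 //.
by rewrite (leq_trans (size_l a b)) // (leq_trans _ (leq_addr _ _)) // leq_mul2r le_Cc orbT.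
Qed.

(** Multiplying the digit relations by [Psi], taken at y = x^E, leaves [D] times a single digit. The
    relations have [s < S] and the factors shift by less than [M * E], so a remainder of at least
    [(S + M) * E] modulo [P] leaves room for all of them; there the products with [l a b] and with
    its digit agree. *)
Lemma interior_coef_eq0 S (D : {poly K}) (Psi : idx -> 'I_S -> {poly K}) M a b N :
    (forall i j, \sum_s Psi i s * sep_coef F G s j = D *+ (i == j)) ->
    (forall i s, size (Psi i s) <= M)%N -> (size D <= M)%N ->
  ((S + M) * E <= N %% P)%N -> ((D \Po 'X^E) * l a b)`_N = 0.
Proof.
move=> PsiD size_Psi size_D le_N.
have lt_NP : (N %% P < P)%N by rewrite ltn_mod.
have le_Em m : (m < M)%N -> (E * m <= N %% P)%N by nia.
(* Past the last digit every shifted index is still at least [C * P], where [l a b] vanishes. *)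
have [le_C|lt_C] := leqP C (N %/ P).
  rewrite (coef_comp_XnM _ _ _ size_D) big1 // => m _.
  rewrite [(l a b)`_ _]nth_default ?if_same ?mulr0 // (leq_trans (size_l a b)) //.
  by have := le_Em m (ltn_ord m); rewrite {2}(divn_eq N P); nia.
pose i : idx := (a, b, Ordinal lt_C).
transitivity (((D \Po 'X^E) * digit i)`_(N %% P)).
  rewrite !(coef_comp_XnM _ _ _ size_D); apply: eq_bigr => m _.
  have le_m := le_Em m (ltn_ord m).
  rewrite coef_digit ?(leq_ltn_trans (leq_subr _ _)) //= !ltnNge le_m.
  rewrite (leq_trans le_m (leq_mod _ _)) /= {1}(divn_eq N P) addnBA //.
have -> : (D \Po 'X^E) * digit i = \sum_s (Psi i s \Po 'X^E) *
    \sum_(j : idx) (sep_coef F G s j \Po 'X^E) * digit j.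
  under eq_bigr => s _ do rewrite mulr_sumr.
  rewrite exchange_big /= (bigD1 i) //= [X in _ + X]big1 => [|j neq_ji].
    rewrite addr0; under eq_bigr => s _ do rewrite mulrA -comp_polyM.
    by rewrite -mulr_suml -raddf_sum /= PsiD eqxx.
  under eq_bigr => s _ do rewrite mulrA -comp_polyM.
  by rewrite -mulr_suml -raddf_sum /= PsiD eq_sym (negPf neq_ji) comp_poly0 mul0r.
rewrite coef_sum big1 // => s _; rewrite (coef_comp_XnM _ _ _ (size_Psi i s)).
apply: big1 => m _; have le_m := le_Em m (ltn_ord m); rewrite ltnNge le_m /=.
rewrite digit_relation ?mulr0 ?(leq_ltn_trans (leq_subr _ _)) //.
by rewrite leq_subRL //; have := ltn_ord s; have := ltn_ord m; nia.
Qed.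

End TwoScales.

Section NoRelation.
Variables (K : fieldType) (I J : finType) (F : I -> fps K) (G : J -> fps K).
Hypotheses (freeF : free_family F) (freeG : free_family G).

(* With [X = x ^ P] and [y = x ^ E], [E] small compared to [P], the variables [x], [X] and [y]
   behave as independent ones, so that the relation forces a relation between the
   [F_a(X) G_b(y X)] with coefficients in the field of [y]. *)
Lemma no_two_scale_relation C : exists B, forall P E (l : I -> J -> {poly K}),
    (0 < E)%N -> (B * E < P)%N -> (forall a b, size (l a b) <= C * P)%N ->
    \sum_a \sum_b fpoly (l a b) * (fps_subst P (F a) * fps_subst (P + E) (G b)) = 0 ->
  forall a b, l a b = 0.
Proof.
have [S [D [Psi [D_neq0 PsiD]]]] :=
  left_inverse_up_to_scalar (@sep_coef_independent K I J F G freeF freeG C.+1).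
pose M := maxn (size D) (\max_i \max_s size (Psi i s)).
have size_Psi i s : (size (Psi i s) <= M)%N.
  rewrite leq_max; apply/orP; right.
  by rewrite (leq_trans _ (leq_bigmax i)) // (leq_bigmax s).
have size_D : (size D <= M)%N by rewrite leq_maxl.
(* The bound makes [(S + M) * E] smaller than half of [P], so that each remainder modulo [P] is
   large enough, either as it is or after a shift by [h]. *)
exists (2 * (S + M)).+2 => P E l E_gt0 lt_EP size_l rel_l a b.
have P_gt0 : (0 < P)%N by lia.
have size_l' a' b' : (size (l a' b') <= C.+1 * P)%N.
  by rewrite (leq_trans (size_l a' b')) // leq_mul2r leqnSn orbT.
(* Multiplying by x^h moves the small remainders to the middle of the period; this adds at most one
   digit, whence [C.+1]. *)
pose h := (P %/ 2)%N; pose lh a b := 'X^h * l a b.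
have size_lh a' b' : (size (lh a' b') <= C.+1 * P)%N.
  rewrite (leq_trans (size_polyMleq _ _)) // size_polyXn /=.
  by rewrite mulSn leq_add // /h leq_div.
have rel_lh : \sum_a \sum_b fpoly (lh a b) *
    (fps_subst P (F a) * fps_subst (P + E) (G b)) = 0.
  have := congr1 (fun u => fpoly 'X^h * u) rel_l; rewrite mulr0 mulr_sumr.
  apply: etrans; apply: eq_bigr => a' _.
  by rewrite mulr_sumr; apply: eq_bigr => b' _; rewrite rmorphM -mulrA.
have Dl0 : (D \Po 'X^E) * l a b = 0.
  apply/polyP => N; rewrite coef0.
  have [le_N|lt_N] := leqP ((S + M) * E) (N %% P).
    exact: (@interior_coef_eq0 K I J F G _ P E l _ _ size_l' rel_l S D Psi M).
  have := @interior_coef_eq0 K I J F G _ P E lh P_gt0 E_gt0 size_lh rel_lh S D Psi M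
    a b (N + h)%N PsiD size_Psi size_D.
  rewrite /lh mulrCA coefXnM ltnNge leq_addl /= addnK; apply.
  rewrite -modnDml modn_small; rewrite /h; nia.
apply/eqP; move/eqP: Dl0; rewrite mulf_eq0 => /orP[|//].
by rewrite comp_poly_eq0 ?(negPf D_neq0) // size_polyXn ltnS.
Qed.

End NoRelation.

(** * Close powers *)

(** Pigeonhole on the ratios of p2^l to the largest power of p1 below it, which lie in [1, p1):
    among [M * p1 + 1] exponents two ratios differ by less than 1/M, and their quotient is close to
    1. Independence keeps the two resulting powers distinct. *)
Lemma close_powers p1 p2 M : (1 < p1)%N -> (1 < p2)%N ->
    (forall k l, p1 ^ k = p2 ^ l -> l = 0)%N ->
  exists k l, [/\ p1 ^ k != p2 ^ l, M * (p2 ^ l - p1 ^ k) < p1 ^ k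
                & M * (p1 ^ k - p2 ^ l) < p1 ^ k]%N.
Proof.
move=> p1_gt1 p2_gt1 indep.
wlog M_gt0 : M / (0 < M)%N.
  move=> /(_ M.+1 isT)[k [l [neq lt1 lt2]]]; exists k, l; split=> //.
    by apply: leq_ltn_trans lt1; rewrite leq_mul2r leqnSn orbT.
  by apply: leq_ltn_trans lt2; rewrite leq_mul2r leqnSn orbT.
pose k l := trunc_log p1 (p2 ^ l).
have p2X_gt0 l : (0 < p2 ^ l)%N by rewrite expn_gt0 (ltnW p2_gt1).
have p1X_gt0 l : (0 < p1 ^ l)%N by rewrite expn_gt0 (ltnW p1_gt1).
have le_k l : (p1 ^ k l <= p2 ^ l)%N by apply: trunc_logP.
have lt_k l : (p2 ^ l < p1 ^ (k l).+1)%N by apply: trunc_log_ltn.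
pose v l := ((M * p2 ^ l) %/ p1 ^ k l)%N.
have lt_v l : (v l < M * p1)%N.
  by rewrite ltn_divLR // -mulnA ltn_mul2l M_gt0 -expnS lt_k.
have : ~~ injectiveb (fun l : 'I_(M * p1).+1 => Ordinal (lt_v l)).
  by apply/negP => /injectiveP/leq_card; rewrite !card_ord ltnn.
move=> /injectivePn[x [y neq_xy /(congr1 val) /= eq_v]].
wlog lt_xy : x y neq_xy eq_v / (x < y)%N.
  move=> wl; have := neq_xy; rewrite -val_eqE /= neq_ltn => /orP[/wl|lt_yx]; first exact.
  by apply: (wl y x) => //; rewrite eq_sym.
have le_kxy : (k x <= k y)%N by rewrite leq_trunc_log // leq_pexp2l // ltnW // ltnW.
exists (k y - k x)%N, (y - x)%N.
have eA : (p1 ^ k y = p1 ^ k x * p1 ^ (k y - k x))%N by rewrite -expnD subnKC.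
have eB : (p2 ^ y = p2 ^ x * p2 ^ (y - x))%N by rewrite -expnD subnKC // ltnW.
have l1 := leq_trunc_div (M * p2 ^ x) (p1 ^ k x).
have l2 := ltn_ceil (M * p2 ^ x) (p1X_gt0 (k x)).
have l3 := leq_trunc_div (M * p2 ^ y) (p1 ^ k y).
have l4 := ltn_ceil (M * p2 ^ y) (p1X_gt0 (k y)).
move: l1 l2 l3 l4 (le_k x) (p1X_gt0 (k y - k x)%N) (p2X_gt0 x); rewrite -/(v x) -/(v y) -eq_v eA eB.
have : (p1 ^ (k y - k x) != p2 ^ (y - x))%N.
  by apply/eqP => /indep /eqP; rewrite subn_eq0 leqNgt lt_xy.
move: (p1 ^ k x)%N (p1 ^ (k y - k x))%N (p2 ^ x)%N (p2 ^ (y - x))%N (v x) => A P B Q w.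
(* Both M B / A and M B Q / (A P) lie in [w, w + 1), and [A <= B] turns their distance into the two
   bounds. *)
move=> neqPQ l1 l2 l3 l4 le_AB P_gt0 B_gt0; split=> //.
  have ineq : (B * (M * Q) < B * (M * P + P))%N by nia.
  have : (M * Q < M * P + P)%N by rewrite ltn_mul2l in ineq; case/andP: ineq.
  by rewrite mulnBr; lia.
have ineq : (B * (M * P) < B * (M * Q + P))%N by nia.
have : (M * P < M * Q + P)%N by rewrite ltn_mul2l in ineq; case/andP: ineq.
by rewrite mulnBr; lia.
Qed.

(** * Substitution of x^q and linear independence *)

Section SubstFree.
Variables (K : fieldType) (q : nat).
Hypothesis q_gt0 : (0 < q)%N.

Lemma fps_subst_sum (I : finType) (F : I -> fps K) :
  fps_subst q (\sum_i F i) = \sum_i fps_subst q (F i).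
Proof.
apply/funext => n; rewrite fps_sum /fps_subst; case: ifP => // _; first by rewrite fps_sum.
by rewrite big1.
Qed.

Lemma fps_subst_prod (I : finType) (F : I -> fps K) :
  fps_subst q (\prod_i F i) = \prod_i fps_subst q (F i).
Proof. by apply: (big_morph _ (fps_substM q_gt0) (fps_subst1 _ q_gt0)). Qed.

Lemma fps_substX (f : fps K) n : fps_subst q (f ^+ n) = fps_subst q f ^+ n.
Proof.
elim: n => [|n IHn]; first by rewrite fps_subst1.
by rewrite !exprS fps_substM // IHn.
Qed.

Lemma coef_fpoly_subst (l : {poly K}) (f : fps K) n :
  (fpoly l * fps_subst q f) n =
  \sum_(m < n.+1) f m * (if (n < q * m)%N then 0 else l`_(n - q * m)).
Proof.
rewrite mulrC (@fps_mul_eq_upto _ n _ (fpoly (fps_trunc n f \Po 'X^q)) _ (fpoly l)) //; last first.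
  by move=> i le_in; rewrite (fps_subst_trunc q_gt0 _ le_in).
rewrite -rmorphM /= fpolyE (@coef_comp_XnM _ n.+1) ?size_poly //.
by apply: eq_bigr => m _; rewrite (@fps_truncE _ n n _ _ (ltn_ord m)).
Qed.

(** Split the coefficients by residues modulo [q]: the F_i(x^q) only have exponents divisible by
    [q], so each residue class gives a relation among the F_i themselves. *)
Lemma subst_free (I : finType) (F : I -> fps K) :
  free_family F -> free_family (fun i => fps_subst q (F i)).
Proof.
move=> freeF nu nu0 i; apply/polyP => e; rewrite coef0 (divn_eq e q).
set r := (e %% q)%N; have lt_rq : (r < q)%N by rewrite ltn_mod.
pose mu i := \poly_(j < size (nu i)) (nu i)`_(j * q + r).
have muE i' j : (mu i')`_j = (nu i')`_(j * q + r).
  rewrite coef_poly; case: ltnP => // le_j; rewrite nth_default //.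
  by rewrite (leq_trans le_j) // (leq_trans _ (leq_addr _ _)) // leq_pmulr.
rewrite -muE (_ : mu i = 0) ?coef0 //; move: i; apply: freeF.
apply/funext => N; have := congr1 (fun u : fps K => u (N * q + r)%N) nu0.
rewrite !fps0 !fps_sum; apply: etrans; apply: eq_bigr => i _.
rewrite coef_fpoly_subst mulrC fpsM.
rewrite [RHS](@big_ord_cut _ _ N.+1 (fun m => F i m *
  (if (N * q + r < q * m)%N then 0 else (nu i)`_(N * q + r - q * m)))); last first.
  by move=> m lt_Nm; rewrite (_ : (_ < q * m)%N) ?mulr0 //; nia.
apply: eq_bigr => m _; have le_mN : (m <= N)%N by rewrite -ltnS.
rewrite fpolyE muE (_ : (m < (N * q + r).+1)%N) ?ltnS; last by nia.
rewrite (_ : (N * q + r < q * m)%N = false); last by apply/negbTE; rewrite -leqNgt; nia.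
by congr (_ * _`_ _); rewrite mulnBl mulnC; nia.
Qed.

End SubstFree.

(** * Mahler systems *)

Section Systems.
Variable K : fieldType.

(** Expand the product of sums: its terms are indexed by choice functions. *)
Lemma in_span_prod (I T : finType) (g : T -> I -> fps K) (u : T -> fps K) :
    (forall t, in_span (g t) (u t)) ->
  in_span (fun w : {ffun T -> I} => \prod_t g t (w t)) (\prod_t u t).
Proof.
move=> /choice[d] /choice[nu nuP].
exists (\prod_t d t), (fun w : {ffun T -> I} => \prod_t nu t (w t)); split.
  by apply/prodf_neq0 => t _; case: (nuP t).
rewrite rmorph_prod -big_split /=.
under eq_bigr => t _ do rewrite (nuP t).2.
rewrite bigA_distr_bigA; apply: eq_bigr => w _.
by rewrite big_split /= rmorph_prod.
Qed.

Lemma in_span_subst (I : finType) (F : I -> fps K) h q : (0 < q)%N ->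
  in_span F h -> in_span (fun i => fps_subst q (F i)) (fps_subst q h).
Proof.
move=> q_gt0 [d [nu [d_neq0 nuP]]].
exists (d \Po 'X^q), (fun i => nu i \Po 'X^q); split.
  by rewrite comp_poly_eq0 // size_polyXn ltnS.
rewrite -fps_subst_poly // -fps_substM // nuP fps_subst_sum.
by apply: eq_bigr => i _; rewrite fps_substM // fps_subst_poly.
Qed.

(** [F] and its image under x -> x^p are bases of the same space over [K(x)]; the last clause
    amounts to the invertibility of the matrix of the system. *)
Definition mahler_system p (I : finType) (F : I -> fps K) :=
  [/\ free_family F, forall i, in_span F (fps_subst p (F i))
    & forall i, in_span (fun j => fps_subst p (F j)) (F i)].

Section MahlerSystemOfEquation.
Variables (p m : nat) (f : fps K) (a : nat -> {poly K}).
Hypotheses (p_gt0 : (0 < p)%N) (m_gt0 : (0 < m)%N) (am_neq0 : a m != 0).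
Hypothesis rel_f : \sum_(i < m.+1) fpoly (a i) * fps_subst (p ^ i) f = 0.

(** Slot 0 holds the constant 1, so that products of exactly [N] of these contain all monomials of
    degree at most [N] in the f(x^(p^i)), [i < m]. *)
Let g (t : 'I_m.+1) : fps K := if t == 0%N :> nat then 1 else fps_subst (p ^ t.-1) f.

Lemma subst_gen_in_span t : in_span g (fps_subst p (g t)).
Proof.
have gS i : (i < m)%N -> in_span g (fps_subst (p ^ i) f).
  move=> lt_im; have := in_span_gen g (inord i.+1).
  by rewrite {2}/g inordK ?ltnS.
rewrite {2}/g; have [t0|t_neq0] := eqVneq (t : nat) 0%N.
  by have := in_span_gen g t; rewrite fps_subst1 // {2}/g t0.
rewrite fps_subst_comp // -expnS prednK ?lt0n //.
have := ltn_ord t; rewrite ltnS leq_eqVlt => /orP[/eqP->|/gS//].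
have /in_span_trans : forall i : 'I_m, in_span g (fps_subst (p ^ i) f) by move=> i; apply: gS.
apply; exists (a m), (fun i : 'I_m => - a i); split=> //.
move/eqP: rel_f; rewrite big_ord_recr /= addrC addr_eq0 => /eqP->.
by rewrite -sumrN; apply: eq_bigr => i _; rewrite rmorphN mulNr.
Qed.

(** Take a maximal free subfamily of the products [H]. Its span is stable under substitution; its
    image is free of the same size, hence spans the same space, which is the last clause of a
    system. The induction principle on [Q] records that each [F i] is a product of 1 and the
    f(x^(p^k)), [k < m]. *)
Lemma mahler_system_exists N : exists r (F : 'I_r -> fps K),
  [/\ mahler_system p F, forall n, (n <= N)%N -> in_span F (f ^+ n)
    & forall Q : fps K -> Prop, Q 1 -> (forall k, (k < m)%N -> Q (fps_subst (p ^ k) f)) ->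
        (forall u v, Q u -> Q v -> Q (u * v)) -> forall i, Q (F i)].
Proof.
pose H (w : {ffun 'I_N -> 'I_m.+1}) := \prod_t g (w t).
have [r [e [freeF FH]]] := max_free_subfamily H.
have F_subst i : in_span (H \o e) (fps_subst p ((H \o e) i)).
  apply: (in_span_trans FH); rewrite /= fps_subst_prod //.
  by apply: (in_span_prod (g := fun=> g)) => t; apply: subst_gen_in_span.
exists r, (H \o e); split; last first.
- move=> Q Q1 Qf QM i; apply: big_ind => // t _; rewrite /g; case: eqP => // /eqP t0.
  by apply: Qf; rewrite -ltnS prednK ?lt0n // ltn_ord.
- move=> n le_nN; apply: (in_span_trans FH).
  pose u (t : 'I_N) := if (t < n)%N then f else 1.
  have -> : f ^+ n = \prod_t u t.
    rewrite -big_mkcond /= -(big_ord_widen N (fun=> f) le_nN).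
    by rewrite prodr_const card_ord.
  apply: (in_span_prod (g := fun=> g)) => t; rewrite /u; case: ifP => _.
    have := in_span_gen g (inord 1); rewrite {2}/g inordK ?ltnS //=.
    by rewrite expn0 fps_subst_id.
  by have := in_span_gen g ord0; rewrite {2}/g.
- split=> // i; have := in_span_gen (H \o e) i; apply: free_in_span_basis => //.
  exact: subst_free.
Qed.

End MahlerSystemOfEquation.

Lemma size_comp_Xn (l : {poly K}) q : (size (l \Po 'X^q) <= (size l).-1 * q + 1)%N.
Proof.
by rewrite (leq_trans (size_comp_poly_leq _ _)) // size_polyXn addn1.
Qed.

(** The matrix for [k + 1] is the one for [k] times the basic matrix at x^(p^k); degrees add up as a
    geometric series, hence a bound linear in [p ^ k]. *)
Lemma mahler_system_iter p (I : finType) (F : I -> fps K) : (1 < p)%N ->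
    mahler_system p F ->
  exists M, forall k, exists d (A : I -> I -> {poly K}),
    [/\ d != 0, forall i, fpoly d * F i = \sum_j fpoly (A i j) * fps_subst (p ^ k) (F j)
      & forall i j, (size (A i j) <= M * p ^ k)%N].
Proof.
move=> p_gt1 [_ _ /in_span_common[d [A [d_neq0 AP]]]].
pose M := (\max_i \max_j size (A i j))%N; exists M.+1.
have sizeA i j : (size (A i j) <= M)%N.
  by rewrite (leq_trans _ (leq_bigmax i)) // (leq_bigmax j).
(* The strengthened induction hypothesis bounds the degrees by M (p^k - 1); its inductive step uses
   [1 < p]. *)
suff IH k : exists d (A : I -> I -> {poly K}),
    [/\ d != 0, forall i, fpoly d * F i = \sum_j fpoly (A i j) * fps_subst (p ^ k) (F j)
      & forall i j, (size (A i j) + M <= M * p ^ k + 1)%N].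
  move=> k; have [dk [Ak [dk_neq0 AkP sizeAk]]] := IH k; exists dk, Ak; split=> // i j.
  have pk_gt0 : (0 < p ^ k)%N by rewrite expn_gt0 ltnW.
  by have := sizeAk i j; nia.
elim: k => [|k [dk [Ak [dk_neq0 AkP sizeAk]]]].
  exists 1, (fun i j => (i == j)%:R); split=> [|i|i j]; first exact: oner_neq0.
    rewrite rmorph1 mul1r (bigD1 i) //= eqxx rmorph1 mul1r fps_subst_id.
    rewrite big1 ?addr0 // => j; rewrite eq_sym => /negPf->.
    by rewrite rmorph0 mul0r.
  by rewrite expn0 muln1 addnC leq_add2l; case: eqP => _; rewrite ?size_poly1 ?size_poly0.
have pk_gt0 : (0 < p ^ k)%N by rewrite expn_gt0 ltnW.
exists (dk * (d \Po 'X^(p ^ k))), (fun i j => \sum_h Ak i h * (A h j \Po 'X^(p ^ k))).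
split=> [|i|i j].
- by rewrite mulf_neq0 // comp_poly_eq0 // size_polyXn ltnS.
- rewrite rmorphM /= mulrAC AkP mulr_suml.
  transitivity (\sum_h \sum_j fpoly (Ak i h * (A h j \Po 'X^(p ^ k))) *
                  fps_subst (p ^ k.+1) (F j)).
    apply: eq_bigr => h _; rewrite -mulrA [_ * fpoly _]mulrC -fps_subst_poly //.
    rewrite -fps_substM // AP fps_subst_sum mulr_sumr; apply: eq_bigr => j _.
    by rewrite fps_substM // fps_subst_poly // fps_subst_comp // -expnSr rmorphM mulrA.
  by rewrite exchange_big; apply: eq_bigr => j _; rewrite rmorph_sum mulr_suml.
- have leM : (M <= M * p ^ k.+1 + 1)%N.
    by rewrite addn1 ltnW // ltnS leq_pmulr // expn_gt0 ltnW.
  rewrite addnC -leq_subRL // (leq_trans (size_sum _ _ _)) //.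
  apply/bigmax_leqP => h _; rewrite leq_subRL // addnC.
  have := size_polyMleq (Ak i h) (A h j \Po 'X^(p ^ k)).
  have := size_comp_Xn (A h j) (p ^ k); have := sizeAk i h; have := sizeA h j.
  rewrite expnS; nia.
Qed.

(** A vector killed by the matrix gives a relation among the [F i]. *)
Lemma mahler_system_nonsingular p (I : finType) (F : I -> fps K) k d (A : I -> I -> {poly K}) :
    free_family F -> d != 0 ->
    (forall i, fpoly d * F i = \sum_j fpoly (A i j) * fps_subst (p ^ k) (F j)) ->
  forall v : I -> {poly K}, (forall j, \sum_i v i * A i j = 0) -> forall i, v i = 0.
Proof.
move=> freeF d_neq0 AP v vA; apply: freeF; apply: (fpoly_mulI d_neq0).
rewrite mulr0 mulr_sumr; under eq_bigr => i _ do rewrite mulrCA AP mulr_sumr.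
rewrite exchange_big big1 // => j _; under eq_bigr => i _ do rewrite mulrA -rmorphM.
by rewrite -mulr_suml -rmorph_sum /= vA rmorph0 mul0r.
Qed.

End Systems.

(** * Independence of products of two Mahler systems *)

Section Products.
Variable K : fieldType.

Lemma free_pairs (I J : finType) (H : I * J -> fps K) :
  (forall l : I -> J -> {poly K}, \sum_i \sum_j fpoly (l i j) * H (i, j) = 0 ->
     forall i j, l i j = 0) -> free_family H.
Proof.
move=> indep nu nu0 [i j]; apply: (indep (fun i j => nu (i, j))).
by rewrite pair_big /= -[RHS]nu0; apply: eq_bigr => -[].
Qed.

Lemma size_mul3 (a b c : {poly K}) : (size (a * b * c)%R <= size a + size b + size c)%N.
Proof.
have := size_polyMleq (a * b) c; have := size_polyMleq a b; lia.
Qed.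

(** Iterating the systems up to nearly equal powers [P] and [Q] turns the matrix [l] into A^T l A',
    small enough for [no_two_scale_relation], where the smaller power is the base scale.
    Nonsingularity of [A] and [A'] carries the vanishing back to [l]. *)
Lemma mahler_products_free p1 p2 (I J : finType) (F : I -> fps K) (G : J -> fps K) :
    (1 < p1)%N -> (1 < p2)%N -> (forall k l, p1 ^ k = p2 ^ l -> l = 0)%N ->
    mahler_system p1 F -> mahler_system p2 G ->
  free_family (fun ij : I * J => F ij.1 * G ij.2).
Proof.
move=> p1_gt1 p2_gt1 indep sysF sysG; apply: free_pairs => l rel_l.
have [freeF _ _] := sysF; have [freeG _ _] := sysG.
have [M1 iterF] := mahler_system_iter p1_gt1 sysF.
have [M2 iterG] := mahler_system_iter p2_gt1 sysG.
pose e := (\max_i \max_j size (l i j))%N.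
have size_l i j : (size (l i j) <= e)%N.
  by rewrite (leq_trans _ (leq_bigmax i)) // (leq_bigmax j).
(* Chosen so that [e + M1 * P + M2 * Q] is at most [C] times the smaller power, each power being at
   most twice the other. *)
pose C := (e + 2 * M1 + 2 * M2)%N.
have [B1 coreFG] := no_two_scale_relation freeF freeG C.
have [B2 coreGF] := no_two_scale_relation freeG freeF C.
(* [B1] and [B2] serve the two possible orders; the extra 2 gives the factor-two comparison and
   converts a bound by [P] into one by [Q] when [Q < P]. *)
have [k [n [neq lt1 lt2]]] := close_powers (B1 + B2 + 2) p1_gt1 p2_gt1 indep.
have [d1 [A [d1_neq0 AP sizeA]]] := iterF k.
have [d2 [A' [d2_neq0 AP' sizeA']]] := iterG n.
have nsA := mahler_system_nonsingular freeF d1_neq0 AP.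
have nsA' := mahler_system_nonsingular freeG d2_neq0 AP'.
have P_gt0 : (0 < p1 ^ k)%N by rewrite expn_gt0 ltnW.
have Q_gt0 : (0 < p2 ^ n)%N by rewrite expn_gt0 ltnW.
move: neq lt1 lt2 P_gt0 Q_gt0 AP AP' sizeA sizeA'.
move: (p1 ^ k)%N (p2 ^ n)%N => P Q neq lt1 lt2 P_gt0 Q_gt0 AP AP' sizeA sizeA'.
pose l' c d := \sum_a \sum_b l a b * A a c * A' b d.
have rel_l' : \sum_c \sum_d fpoly (l' c d) * (fps_subst P (F c) * fps_subst Q (G d)) = 0.
  have := congr1 (fun u => fpoly d1 * fpoly d2 * u) rel_l.
  rewrite mulr0 pair_big mulr_sumr /=; apply: etrans.
  transitivity (\sum_(ab : I * J) \sum_(cd : I * J)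
    fpoly (l ab.1 ab.2 * A ab.1 cd.1 * A' ab.2 cd.2) *
      (fps_subst P (F cd.1) * fps_subst Q (G cd.2))).
    rewrite [LHS]pair_big [RHS]exchange_big /=; apply: eq_bigr => cd _.
    by rewrite /l' pair_big /= rmorph_sum mulr_suml.
  apply: eq_bigr => -[a b] _ /=; transitivity (fpoly (l a b) *
      ((fpoly d1 * F a) * (fpoly d2 * G b))); last by ring.
  rewrite AP AP' mulr_suml mulr_sumr -(pair_big predT predT (fun c d =>
    fpoly (l a b * A a c * A' b d) * (fps_subst P (F c) * fps_subst Q (G d)))) /=.
  apply: eq_bigr => c _; rewrite mulr_sumr mulr_sumr; apply: eq_bigr => d _.
  by rewrite !rmorphM /=; ring.
have size_l' c d : (size (l' c d) <= e + M1 * P + M2 * Q)%N.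
  rewrite /l' (leq_trans (size_sum _ _ _)) //; apply/bigmax_leqP => a _.
  rewrite (leq_trans (size_sum _ _ _)) //; apply/bigmax_leqP => b _.
  by rewrite (leq_trans (size_mul3 _ _ _)) // !leq_add.
have l'_eq0 : (forall c d, l' c d = 0) -> forall a b, l a b = 0.
  move=> l'0 a; apply: nsA' => d; move: a; apply: nsA => c.
  rewrite -[RHS](l'0 c d); apply: eq_bigr => a _; rewrite mulr_suml.
  by apply: eq_bigr => b _; rewrite mulrAC.
have size_le A2 : (0 < A2)%N -> (P <= 2 * A2)%N -> (Q <= 2 * A2)%N ->
    (e + M1 * P + M2 * Q <= C * A2)%N.
  move=> A2_gt0 le_P le_Q.
  have := leq_mul (leqnn M1) le_P; have := leq_mul (leqnn M2) le_Q.
  by have := leq_pmulr e A2_gt0; rewrite /C; nia.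
apply: l'_eq0; case: (ltngtP P Q) neq => // [lt_PQ|lt_QP] _.
  apply: (coreFG P (Q - P)%N).
  - by rewrite subn_gt0.
  - by nia.
  - by move=> c d; apply: leq_trans (size_l' c d) (size_le P _ _ _) => //; nia.
  - by rewrite subnKC // ltnW.
move=> c d; move: d c; apply: (coreGF Q (P - Q)%N (fun d c => l' c d)).
- by rewrite subn_gt0.
- by nia.
- by move=> d c; apply: leq_trans (size_l' c d) (size_le Q _ _ _) => //; nia.
rewrite (subnKC (ltnW lt_QP)) -[RHS]rel_l' exchange_big /=.
by apply: eq_bigr => c _; apply: eq_bigr => d _; rewrite [fps_subst Q _ * _]mulrC.
Qed.

Definition algebraic_fps (f : fps K) := exists n, ~ free_family (fun i : 'I_n => f ^+ i).

(** As neither series is algebraic, the powers of each are free, so the matrices [nu] and [mu]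
    expressing them have trivial left kernel. Freeness of the products [F a * G b] gives nu^T c mu =
    0, hence c = 0. *)
Lemma relation_algebraic p1 p2 (I J : finType) (F : I -> fps K) (G : J -> fps K)
    (f g : fps K) N (c : 'I_N -> 'I_N -> {poly K}) :
    (1 < p1)%N -> (1 < p2)%N -> (forall k l, p1 ^ k = p2 ^ l -> l = 0)%N ->
    mahler_system p1 F -> mahler_system p2 G ->
    (forall i : 'I_N, in_span F (f ^+ i)) -> (forall i : 'I_N, in_span G (g ^+ i)) ->
    \sum_i \sum_j fpoly (c i j) * (f ^+ i * g ^+ j) = 0 ->
    ~ algebraic_fps f -> ~ algebraic_fps g ->
  forall i j, c i j = 0.
Proof.
move=> p1_gt1 p2_gt1 indep sysF sysG Ff Gg rel algf algg.
have freef : free_family (fun i : 'I_N => f ^+ i).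
  by apply: contrapT => nf; apply: algf; exists N.
have freeg : free_family (fun i : 'I_N => g ^+ i).
  by apply: contrapT => ng; apply: algg; exists N.
have [d [nu [d_neq0 nuP]]] := in_span_common Ff.
have [e [mu [e_neq0 muP]]] := in_span_common Gg.
pose l (ab : I * J) := \sum_i \sum_j c i j * nu i ab.1 * mu j ab.2.
have l0 : forall ab, l ab = 0.
  apply: (mahler_products_free p1_gt1 p2_gt1 indep sysF sysG).
  have := congr1 (fun u => fpoly d * fpoly e * u) rel.
  rewrite mulr0 pair_big mulr_sumr /=; apply: etrans.
  transitivity (\sum_(ij : 'I_N * 'I_N) \sum_(ab : I * J)
    fpoly (c ij.1 ij.2 * nu ij.1 ab.1 * mu ij.2 ab.2) * (F ab.1 * G ab.2)).
    rewrite [RHS]exchange_big /=; apply: eq_bigr => ab _.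
    by rewrite /l pair_big /= rmorph_sum mulr_suml.
  apply: eq_bigr => -[i j] _ /=; transitivity (fpoly (c i j) *
      ((fpoly d * f ^+ i) * (fpoly e * g ^+ j))); last by ring.
  rewrite nuP muP mulr_suml mulr_sumr -(pair_big predT predT (fun a b =>
    fpoly (c i j * nu i a * mu j b) * (F a * G b))) /=.
  apply: eq_bigr => a _; rewrite mulr_sumr mulr_sumr; apply: eq_bigr => b _.
  by rewrite !rmorphM /=; ring.
have free_pull (T : finType) (u : 'I_N -> fps K) (H : T -> fps K) (D : {poly K}) ku :
    free_family u -> D != 0 -> (forall i, fpoly D * u i = \sum_t fpoly (ku i t) * H t) ->
    forall v, (forall t, \sum_i v i * ku i t = 0) -> forall i, v i = 0.
  move=> freeu D_neq0 kuP v v0; apply: freeu; apply: (fpoly_mulI D_neq0).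
  rewrite mulr0 mulr_sumr; under eq_bigr => i _ do rewrite mulrCA kuP mulr_sumr.
  rewrite exchange_big big1 // => t _; under eq_bigr => i _ do rewrite mulrA -rmorphM.
  by rewrite -mulr_suml -rmorph_sum /= v0 rmorph0 mul0r.
move=> i; apply: (free_pull _ _ _ _ _ freeg e_neq0 muP) => b; move: i.
apply: (free_pull _ _ _ _ _ freef d_neq0 nuP) => a.
rewrite -[RHS](l0 (a, b)); apply: eq_bigr => i _; rewrite mulr_suml.
by apply: eq_bigr => j _; rewrite mulrAC.
Qed.

End Products.

(** * Algebraic Mahler series *)

Section ZeroEstimate.
Variable K : fieldType.

Lemma fps_exp_low (u : fps K) o j : (forall i, (i < o)%N -> u i = 0) ->
  (forall i, (i < j * o)%N -> (u ^+ j) i = 0) /\ (u ^+ j) (j * o)%N = u o ^+ j.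
Proof.
move=> u0; elim: j => [|j [IH1 IH2]].
  by split=> [i|]; rewrite mul0n ?expr0 ?fps1.
rewrite exprS mulSn; have [l1 l2] := fps_mul_low u0 IH1.
by split=> //; rewrite l2 IH2 exprS.
Qed.

(* For [i < o], [o] the order of [u], the products [x ^ i * u ^ j] have distinct orders. *)
Lemma distinct_orders_independent (u : fps K) o L (k : 'I_o -> 'I_L -> K) :
    (forall i, (i < o)%N -> u i = 0) -> u o != 0 ->
    \sum_i \sum_j fpoly (k i j)%:P * (fpoly 'X^i * u ^+ j) = 0 ->
  forall i j, k i j = 0.
Proof.
move=> u0 uo rel.
(* Induction on the order [i + j * o], which determines [i] and [j] since [i < o]. In coefficient
   [N] the terms of smaller order are gone by induction and those of larger order do not
   contribute. *)
suff H N : forall (i : 'I_o) (j : 'I_L), (i + j * o = N)%N -> k i j = 0.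
  by move=> i j; apply: H erefl.
elim/ltn_ind: N => N IH i j eN.
have [low topj] := fps_exp_low j u0.
have := congr1 (fun f : fps K => f N) rel; rewrite fps0 fps_sum (bigD1 i) //=.
rewrite [X in _ + X]big1 ?addr0 => [|i' neq_i]; last first.
  rewrite fps_sum big1 // => j' _; rewrite fpolyC_M fpoly_XnM.
  have [lt_N|le_N] := ltnP (i' + j' * o) N; first by rewrite (IH _ lt_N) ?mul0r.
  case: ltnP => // le_i; rewrite ?mulr0 //.
  rewrite (fps_exp_low j' u0).1 ?mulr0 // ltn_subLR // ltn_neqAle le_N andbT.
  apply: contra neq_i => /eqP; rewrite -eN => e; apply/eqP/val_inj => /=.
  have := congr1 (fun t => t %% o)%N e; rewrite ![(_ + _ * o)%N]addnC !modnMDl.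
  by rewrite !modn_small.
rewrite fps_sum (bigD1 j) //= [X in _ + X]big1 ?addr0 => [|j' neq_j]; last first.
  rewrite fpolyC_M fpoly_XnM.
  have [lt_N|le_N] := ltnP (i + j' * o) N; first by rewrite (IH _ lt_N) ?mul0r.
  case: ltnP => // le_i; rewrite ?mulr0 //.
  rewrite (fps_exp_low j' u0).1 ?mulr0 // ltn_subLR // ltn_neqAle le_N andbT.
  apply: contra neq_j => /eqP; rewrite -eN => /addnI/eqP; rewrite eqn_mul2r.
  by case/orP=> [/eqP o0|/eqP/val_inj->//]; have := ltn_ord i; lia.
rewrite fpolyC_M fpoly_XnM -eN ltnNge leq_addr /= addKn topj => /eqP.
by rewrite mulf_eq0 expf_eq0 (negPf uo) andbF orbF => /eqP.
Qed.

(** Multiplication by [u] on the reduced monomials in the [g s] raises degrees by at most [B], and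
    these monomials span at most [#|T|] dimensions. If [o] exceeded [#|T| * B], counting
    coefficients would give a relation with constant coefficients between the x^i u^j, [i < o],
    [j < L], which have distinct orders. The bound is independent of the number of series [g s],
    which is what the application to sections calls for. *)
Lemma zero_estimate (T S : finType) (E : T -> fps K) (g : S -> fps K) n
    (c : S -> nat -> {poly K}) (k : S -> K) B (u : fps K) o :
    (0 < n)%N ->
    (forall s, g s ^+ n = \sum_(i < n) fpoly (c s i) * g s ^+ i) ->
    (forall s i, (size (c s i) <= B.+1)%N) ->
    (forall w : {ffun S -> 'I_n}, in_span E (\prod_s g s ^+ w s)) ->
    u = \sum_s fpoly (k s)%:P * g s ->
    (forall i, (i < o)%N -> u i = 0) -> u o != 0 ->
  (o <= #|T| * B)%N.
Proof.
move=> n_gt0 gn size_c /in_span_common[q [nu [q_neq0 nuP]]] uE u0 uo.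
rewrite leqNgt; apply/negP => lt_o.
pose W := {ffun S -> 'I_n}; pose e (w : W) : fps K := \prod_s g s ^+ w s.
(* Raising the exponent of [g s] by one either stays below [n] or calls for the integral
   equation. *)
have mulg s w : exists V : W -> {poly K},
    g s * e w = \sum_w' fpoly (V w') * e w' /\ forall w', (size (V w') <= B.+1)%N.
  pose upd (i : 'I_n) : W := [ffun t => if t == s then i else w t].
  have e_upd i : e (upd i) = g s ^+ i * \prod_(t | t != s) g t ^+ w t.
    rewrite /e (bigD1 s) //= ffunE eqxx; congr (_ * _).
    by apply: eq_bigr => t /negPf neq; rewrite ffunE neq.
  have upd_inj : injective upd.
    by move=> i j /ffunP/(_ s); rewrite !ffunE eqxx.
  have eE : e w = g s ^+ w s * \prod_(t | t != s) g t ^+ w t by rewrite /e (bigD1 s).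
  have [lt_w|le_w] := ltnP (w s).+1 n.
    exists (fun w' => (w' == upd (Ordinal lt_w))%:R); split=> [|w']; last first.
      by case: eqP => _; rewrite ?size_poly1 ?size_poly0.
    rewrite (bigD1 (upd (Ordinal lt_w))) //= eqxx rmorph1 mul1r big1 ?addr0.
      by rewrite e_upd eE mulrA -exprS.
    by move=> w' /negPf->; rewrite rmorph0 mul0r.
  have ewn : (w s).+1 = n by apply/eqP; rewrite eqn_leq le_w andbT ltn_ord.
  exists (fun w' => \sum_(i < n | w' == upd i) c s i); split=> [|w'].
    rewrite eE mulrA -exprS ewn gn mulr_suml.
    transitivity (\sum_w' \sum_(i < n) (if w' == upd i then fpoly (c s i) * e w' else 0)).
      rewrite exchange_big; apply: eq_bigr => i _ /=.
      by rewrite -big_mkcond /= big_pred1_eq e_upd mulrA.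
    apply: eq_bigr => w' _; rewrite -big_mkcond /= rmorph_sum mulr_suml.
    by apply: eq_bigr.
  rewrite (leq_trans (size_sum _ _ _)) //; apply/bigmax_leqP => i _; exact: size_c.
have [V VP] := choice (fun sw : S * W => mulg sw.1 sw.2).
have mulu w : exists U : W -> {poly K},
    u * e w = \sum_w' fpoly (U w') * e w' /\ forall w', (size (U w') <= B.+1)%N.
  exists (fun w' => \sum_s (k s)%:P * V (s, w) w'); split=> [|w'].
    transitivity (\sum_s \sum_w' fpoly ((k s)%:P * V (s, w) w') * e w').
      rewrite uE mulr_suml; apply: eq_bigr => s _; rewrite -mulrA (VP (s, w)).1 mulr_sumr.
      by apply: eq_bigr => w' _; rewrite rmorphM mulrA.
    by rewrite exchange_big; apply: eq_bigr => w' _; rewrite rmorph_sum mulr_suml.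
  rewrite (leq_trans (size_sum _ _ _)) //; apply/bigmax_leqP => s _.
  rewrite mul_polyC (leq_trans (size_scale_leq _ _)) //; exact: (VP (s, w)).2.
have [U UP] := choice mulu.
have expu j : exists Y : W -> {poly K},
    u ^+ j = \sum_w fpoly (Y w) * e w /\ forall w, (size (Y w) <= j * B + 1)%N.
  elim: j => [|j [Y [YP sizeY]]].
    pose w0 : W := [ffun=> Ordinal n_gt0].
    exists (fun w => (w == w0)%:R); split=> [|w]; last first.
      by case: eqP => _; rewrite ?size_poly1 ?size_poly0.
    rewrite (bigD1 w0) //= eqxx rmorph1 mul1r [X in _ + X]big1 => [|w /negPf->].
      by rewrite addr0 /e big1 // => s _; rewrite ffunE.
    by rewrite rmorph0 mul0r.
  exists (fun w' => \sum_w Y w * U w w'); split=> [|w'].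
    transitivity (\sum_w \sum_w' fpoly (Y w * U w w') * e w').
      rewrite exprS YP mulr_sumr; apply: eq_bigr => w _; rewrite mulrCA (UP w).1 mulr_sumr.
      by apply: eq_bigr => w' _; rewrite rmorphM mulrA.
    by rewrite exchange_big; apply: eq_bigr => w' _; rewrite rmorph_sum mulr_suml.
  rewrite (leq_trans (size_sum _ _ _)) //; apply/bigmax_leqP => w _.
  rewrite (leq_trans (size_polyMleq _ _)) //.
  by have := sizeY w; have := (UP w).2 w'; lia.
have [Y YP] := choice expu.
pose b := (\max_w \max_t size (nu w t))%N.
have size_nu w t : (size (nu w t) <= b)%N.
  by rewrite (leq_trans _ (leq_bigmax w)) // (leq_bigmax t).
(* [Z] bounds the number of coefficients of each [mu y t], and [L] is large enough for
   [o * L > #|T| * Z], because [o > #|T| * B]. *)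
pose L := (#|T| * (o + b + 1)).+1; pose Z := (o + L * B + b + 1)%N.
pose mu (y : 'I_o * 'I_L) t := 'X^(y.1) * \sum_w Y y.2 w * nu w t.
have muP (y : 'I_o * 'I_L) : fpoly q * (fpoly 'X^(y.1) * u ^+ y.2) = \sum_t fpoly (mu y t) * E t.
  transitivity (\sum_w \sum_t fpoly ('X^(y.1) * (Y y.2 w * nu w t)) * E t).
    rewrite (YP y.2).1 mulrCA mulr_sumr mulr_sumr; apply: eq_bigr => w _.
    rewrite [fpoly q * _]mulrCA nuP mulr_sumr mulr_sumr; apply: eq_bigr => t _.
    by rewrite !rmorphM /=; ring.
  rewrite exchange_big; apply: eq_bigr => t _.
  by rewrite /mu mulr_sumr rmorph_sum mulr_suml.
have size_mu y t : (size (mu y t) <= Z)%N.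
  rewrite (leq_trans (size_polyMleq _ _)) // size_polyXn.
  have : (size (\sum_w Y y.2 w * nu w t)%R <= L * B + 1 + b)%N.
    rewrite (leq_trans (size_sum _ _ _)) //; apply/bigmax_leqP => w _.
    rewrite (leq_trans (size_polyMleq _ _)) //.
    have := (YP y.2).2 w; have := size_nu w t.
    have : (y.2 * B <= L * B)%N by rewrite leq_mul2r ltnW ?orbT.
    by lia.
  by have := ltn_ord y.1; rewrite /Z; lia.
have [|v [[y vy] vP]] := @kernel_vector K ('I_o * 'I_L)%type (T * 'I_Z)%type
    (fun y tz => (mu y tz.1)`_tz.2).
  rewrite !card_prod !card_ord /Z.
  have : ((#|T| * B).+1 * L <= o * L)%N by rewrite leq_mul2r lt_o orbT.
  by rewrite /L; nia.
have := @distinct_orders_independent u o L (fun i j => v (i, j)) u0 uo _ y.1 y.2.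
rewrite -surjective_pairing => v0; move/eqP: vy; apply; apply: v0.
apply: (fpoly_mulI q_neq0); rewrite mulr0 pair_big mulr_sumr /=.
transitivity (\sum_y' \sum_t fpoly ((v y')%:P * mu y' t) * E t).
  apply: eq_bigr => y' _; rewrite -surjective_pairing mulrCA muP mulr_sumr.
  by apply: eq_bigr => t _; rewrite mulrA -rmorphM.
rewrite exchange_big big1 // => t _; rewrite -mulr_suml -rmorph_sum /=.
suff -> : \sum_y' (v y')%:P * mu y' t = 0 by rewrite rmorph0 mul0r.
apply/polyP => z; rewrite coef_sum coef0; have [lt_zZ|le_Zz] := ltnP z Z.
  by rewrite -[RHS](vP (t, Ordinal lt_zZ)); apply: eq_bigr => y' _; rewrite coefCM.
by apply: big1 => y' _; rewrite coefCM nth_default ?mulr0 // (leq_trans (size_mu _ _)).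
Qed.

End ZeroEstimate.

(** * Algebras generated by finitely many algebraic series *)

Section AlgebraicSpan.
Variables (K : fieldType) (m n : nat) (f : 'I_m -> fps K).
Hypothesis alg_f : forall i, exists2 c : nat -> {poly K}, c n != 0 &
  \sum_(j < n.+1) fpoly (c j) * f i ^+ j = 0.
Hypothesis n_gt0 : (0 < n)%N.

Definition reduced_monomial (e : {ffun 'I_m -> 'I_n}) : fps K := \prod_i f i ^+ e i.

Lemma in_span_mul (I : finType) (F : I -> fps K) u v :
    (forall i j, in_span F (F i * F j)) -> in_span F u -> in_span F v ->
  in_span F (u * v).
Proof.
move=> FM [d [nu [d_neq0 nuP]]] [e [mu [e_neq0 muP]]].
have : in_span (fun ij : I * I => F ij.1 * F ij.2) (u * v).
  exists (d * e), (fun ij => nu ij.1 * mu ij.2); split; first by rewrite mulf_neq0.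
  transitivity ((fpoly d * u) * (fpoly e * v)); first by rewrite rmorphM /=; ring.
  rewrite nuP muP mulr_suml -(pair_big predT predT (fun i j =>
    fpoly (nu i * mu j) * (F i * F j))) /=.
  apply: eq_bigr => i _; rewrite mulr_sumr; apply: eq_bigr => j _.
  by rewrite rmorphM /=; ring.
by apply: in_span_trans => -[i j]; apply: FM.
Qed.

(** The equation of degree [n] expresses the power [n] by lower ones; iterate. *)
Lemma in_span_small_powers i k : in_span (fun j : 'I_n => f i ^+ j) (f i ^+ k).
Proof.
elim: k => [|k]; first exact: (in_span_gen (fun j : 'I_n => f i ^+ j) (Ordinal n_gt0)).
have step (j : 'I_n) : in_span (fun j : 'I_n => f i ^+ j) (f i * f i ^+ j).
  rewrite -exprS; have [lt_j|le_j] := ltnP j.+1 n.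
    exact: (in_span_gen (fun j : 'I_n => f i ^+ j) (Ordinal lt_j)).
  have -> : j.+1 = n by apply/eqP; rewrite eqn_leq le_j andbT ltn_ord.
  have [c cn_neq0] := alg_f i; rewrite big_ord_recr /= addrC => /eqP.
  rewrite addr_eq0 => /eqP rel; exists (c n), (fun j : 'I_n => - c j); split=> //.
  by rewrite rel -sumrN; apply: eq_bigr => t _; rewrite rmorphN mulNr.
move=> [d [nu [d_neq0 nuP]]]; apply: (in_span_trans step).
exists d, nu; split=> //; rewrite exprS mulrCA nuP mulr_sumr.
by apply: eq_bigr => j _; rewrite mulrCA.
Qed.

Lemma in_span_monomial (k : 'I_m -> nat) :
  in_span reduced_monomial (\prod_i f i ^+ k i).
Proof.
exact: (in_span_prod (g := fun i (j : 'I_n) => f i ^+ j)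
         (fun i => in_span_small_powers i (k i))).
Qed.

Lemma in_span_reduced1 : in_span reduced_monomial 1.
Proof.
by have := in_span_monomial (fun=> 0%N); rewrite big1.
Qed.

Lemma in_span_reducedX i : in_span reduced_monomial (f i).
Proof.
have := in_span_monomial (fun j => (j == i)%N : nat).
by rewrite (bigD1 i) //= eqxx big1 ?mulr1 // => j /negPf->.
Qed.

Lemma in_span_reducedM u v : in_span reduced_monomial u ->
  in_span reduced_monomial v -> in_span reduced_monomial (u * v).
Proof.
apply: in_span_mul => e e'; rewrite /reduced_monomial -big_split /=.
under eq_bigr => i _ do rewrite -exprD.
exact: in_span_monomial.
Qed.

Lemma in_span_reduced_prod (S : finType) (u : S -> fps K) :
  (forall s, in_span reduced_monomial (u s)) -> in_span reduced_monomial (\prod_s u s).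
Proof.
move=> uP; apply: big_ind => //; [exact: in_span_reduced1|exact: in_span_reducedM].
Qed.

End AlgebraicSpan.

(** * Roots of unity and rationality of algebraic Mahler series *)

Section AlgebraicMahler.
Variable K : closedFieldType.
Hypothesis char0 : forall n, n.+1%:R != 0 :> K.

(** In characteristic 0 the polynomial X^n - 1 is separable, so a closed field contains n distinct
    n-th roots of unity, one of which is primitive. *)
Lemma prim_root_exists n : (0 < n)%N -> exists z : K, n.-primitive_root z.
Proof.
move=> n_gt0; pose p : {poly K} := 'X^n - 1; have [r Dp] := closed_field_poly_normal p.
rewrite (monicP _) ?monicXnsubC // scale1r in Dp.
have rn1 : all n.-unity_root r by apply/allP => z; rewrite -root_prod_XsubC -Dp.
have sz_r : (n < (size r).+1)%N by rewrite -(size_prod_XsubC r id) -Dp size_XnsubC.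
have [|z] := hasP (has_prim_root n_gt0 rn1 _ sz_r); last by exists z.
rewrite -separable_prod_XsubC -Dp separable_Xn_sub_1 //.
by case: n n_gt0 {p Dp rn1 sz_r} => // n _; apply: char0.
Qed.

Lemma sum_unity_powers (z : K) n : z ^+ n = 1 -> z != 1 -> \sum_(i < n) z ^+ i = 0.
Proof.
move=> zn z_neq1; have := subrX1 z n; rewrite zn subrr => /esym/eqP.
by rewrite mulf_eq0 subr_eq0 (negPf z_neq1) => /eqP.
Qed.

Definition rational_fps (f : fps K) := exists A B, B != 0 /\ fpoly B * f = fpoly A.

Lemma mahler_system_pow p (I : finType) (F : I -> fps K) k : (0 < p)%N ->
    mahler_system p F -> mahler_system (p ^ k) F.
Proof.
move=> p_gt0 [freeF F1 F2]; elim: k => [|k [_ IH1 IH2]].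
  have e0 : (fun j => fps_subst (p ^ 0) (F j)) = F by apply/funext => j; rewrite fps_subst_id.
  by split=> // i; [rewrite fps_subst_id|rewrite e0]; apply: in_span_gen.
have pk_gt0 : (0 < p ^ k)%N by rewrite expn_gt0 p_gt0.
split=> // i; first by rewrite expnSr -fps_subst_comp //; apply: (in_span_trans IH1);
  apply: in_span_subst.
apply: in_span_trans (IH2 i) => j; have := in_span_subst pk_gt0 (F2 j).
by congr in_span; apply/funext => t; rewrite fps_subst_comp // -expnSr.
Qed.

(** Write [h] in terms of the F_j(x^P), which the rotation fixes because [z ^+ P = 1]: only the
    polynomial coefficients are rotated, and the F_j(x^P) lie in the span of [F]. *)
Lemma rot_in_span (I : finType) (F : I -> fps K) P z h :
    mahler_system P F -> (0 < P)%N -> z ^+ P = 1 -> in_span F h -> in_span F (fps_rot z h).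
Proof.
move=> [_ F1 F2] P_gt0 zP Fh; have := in_span_trans F2 Fh.
move=> [d [nu [d_neq0 nuP]]]; apply: (in_span_trans F1).
exists (d \Po (z *: 'X)), (fun i => nu i \Po (z *: 'X)); split.
  have z_neq0 : z != 0.
    by apply: contra_eqT zP => /negPn/eqP->; rewrite expr0n gtn_eqF // eq_sym oner_eq0.
  by rewrite comp_poly2_eq0 // size_scale // size_polyX.
rewrite -fps_rot_poly -rmorphM nuP rmorph_sum; apply: eq_bigr => i _.
rewrite rmorphM /= fps_rot_poly; congr (_ * _); apply/funext => n.
rewrite /fps_rot /fps_subst; case: ifP => [/dvdnP[t ->]|]; last by rewrite mulr0.
by rewrite mulnC exprM zP expr1n mul1r.
Qed.

Lemma size_comp_rot (z : K) (q : {poly K}) B : (size q <= B.+1)%N ->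
  (size (q \Po (z *: 'X)) <= B.+1)%N.
Proof.
move=> le_q; rewrite (leq_trans (size_comp_poly_leq _ _)) // ltnS.
have : (size (z *: 'X)%R <= 2)%N by rewrite (leq_trans (size_scale_leq _ _)) // size_polyX.
by move: (size (z *: 'X)%R) => t le_t; nia.
Qed.

(** Cut the relation at its last nonzero coefficient; [c] extends [nu] by zero. *)
Lemma top_coefficient (R : fieldType) n (nu : 'I_n -> {poly R}) (h : nat -> fps R) :
    \sum_i fpoly (nu i) * h i = 0 -> (exists i, nu i != 0) ->
  exists D (c : nat -> {poly R}), c D != 0 /\ \sum_(j < D.+1) fpoly (c j) * h j = 0.
Proof.
move=> rel [i0 nui0]; have [D nuD maxD] := @arg_maxnP _ i0 (fun i => nu i != 0) val nui0.
pose c j := if insub j is Some i then nu i else 0.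
have cE (i : 'I_n) : c i = nu i by rewrite /c valK.
exists D, c; split; first by rewrite cE.
apply: etrans rel; rewrite (big_ord_widen n (fun j => fpoly (c j) * h j)) // big_mkcond.
apply: eq_bigr => i _; rewrite cE; case: ifP => //; have [->|/maxD le_iD] := eqVneq (nu i) 0.
  by rewrite rmorph0 mul0r.
by rewrite ltnS; have -> : (i <= D)%N by [].
Qed.

(** A polynomial multiple [g] of [f] is integral. Whenever [g N != 0], the section of [g] at
    exponents congruent to [N] modulo [p ^ N] has order [N] and is a combination of rotations of
    [g]. The zero estimate bounds [N] by a number independent of [N], so [g] is a polynomial. *)
Lemma algebraic_mahler_rational p m (f : fps K) (a : nat -> {poly K}) :
    (1 < p)%N -> (0 < m)%N -> a m != 0 ->
    \sum_(i < m.+1) fpoly (a i) * fps_subst (p ^ i) f = 0 ->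
  algebraic_fps f -> rational_fps f.
Proof.
move=> p_gt1 m_gt0 am_neq0 rel_f [n /existsNP[nu /not_implyP[rel_nu nu_neq0]]].
have p_gt0 : (0 < p)%N by apply: ltnW.
have [D [c [cD_neq0 rel_c]]] : exists D (c : nat -> {poly K}),
    c D != 0 /\ \sum_(j < D.+1) fpoly (c j) * f ^+ j = 0.
  apply: top_coefficient rel_nu _.
  by move/existsNP: nu_neq0 => [i /eqP]; exists i.
have D_gt0 : (0 < D)%N.
  case: (D) cD_neq0 rel_c => // c0; rewrite big_ord1 expr0 mulr1 => /eqP.
  by rewrite fpoly_eq0 (negPf c0).
pose fs (i : 'I_m) := fps_subst (p ^ i) f.
have alg_fs i : exists2 c : nat -> {poly K}, c D != 0 &
    \sum_(j < D.+1) fpoly (c j) * fs i ^+ j = 0.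
  have pi_gt0 : (0 < p ^ i)%N by rewrite expn_gt0 p_gt0.
  exists (fun j => c j \Po 'X^(p ^ i)); first by rewrite comp_poly_eq0 // size_polyXn ltnS.
  have := congr1 (fps_subst (p ^ i)) rel_c; rewrite fps_subst_sum //.
  have -> : fps_subst (p ^ i) (0 : fps K) = 0.
    by apply/funext => t; rewrite /fps_subst; case: ifP.
  apply: etrans; apply: eq_bigr => j _; rewrite fps_substM // fps_subst_poly //.
  by rewrite fps_substX.
pose E := @reduced_monomial K m D fs.
have [r [F [sysF FX FQ]]] := mahler_system_exists p_gt0 m_gt0 am_neq0 rel_f 1.
have Ff : in_span F f by rewrite -[f]expr1; apply: FX.
have EF i : in_span E (F i).
  apply: FQ; first exact: in_span_reduced1.
    by move=> k lt_k; apply: (in_span_reducedX alg_fs D_gt0 (Ordinal lt_k)).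
  exact: in_span_reducedM.
pose g := fpoly (c D) * f.
have Fg : in_span F g.
  have [d [nu' [d_neq0 nuP]]] := Ff; exists d, (fun i => c D * nu' i); split=> //.
  rewrite mulrCA nuP mulr_sumr; apply: eq_bigr => i _.
  by rewrite rmorphM mulrA.
(* Multiplying the equation of [f] by [c D ^+ D.-1] makes it monic in [g]; [c'] collects the lower
   coefficients, moved to the other side. *)
pose c' i := if (i < D)%N then - (c i * c D ^+ (D.-1 - i)) else 0.
have gD : g ^+ D = \sum_(i < D) fpoly (c' i) * g ^+ i.
  move: rel_c; rewrite big_ord_recr /= addrC => /eqP; rewrite addr_eq0 => /eqP rel_c.
  have eD : fpoly (c D) ^+ D = fpoly (c D) ^+ D.-1 * fpoly (c D) by rewrite -exprSr prednK.
  rewrite /g exprMn eD -mulrA rel_c -sumrN mulr_sumr.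
  apply: eq_bigr => i _; rewrite /c' ltn_ord exprMn.
  have {1}-> : D.-1 = (D.-1 - i + i)%N by rewrite subnK // -ltnS prednK.
  by rewrite exprD rmorphN rmorphM rmorphXn /=; ring.
pose B := (\max_(i < D) size (c' i))%N.
have size_c' i : (size (c' i) <= B.+1)%N.
  have [lt_i|le_i] := ltnP i D; last by rewrite /c' ltnNge le_i size_poly0.
  apply: leq_trans (leqnSn _).
  exact: (@leq_bigmax _ (fun j : 'I_D => size (c' j)) (Ordinal lt_i)).
have bound N : g N != 0 -> (N <= #|{ffun 'I_m -> 'I_D}| * B)%N.
  (* As [p ^ N] exceeds [N], the exponent [N] is the least in its class. *)
  move=> gN; have lt_NP : (N < p ^ N)%N by apply: ltn_expl.
  set P := (p ^ N)%N in lt_NP; have P_gt0 : (0 < P)%N by apply: leq_ltn_trans lt_NP.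
  have [z prim_z] := prim_root_exists P_gt0.
  have zsP (s : nat) : (z ^+ s) ^+ P = 1.
    by rewrite -exprM mulnC exprM (prim_expr_order prim_z) expr1n.
  (* The weight is z^(-s N), written with the exponent [P - N]; summing over [s] keeps the exponents
     congruent to [N] modulo [P] and multiplies by [P]. *)
  pose k (s : 'I_P) := (z ^+ s) ^+ (P - N).
  pose u : fps K := \sum_s fpoly (k s)%:P * fps_rot (z ^+ s) g.
  have uE i : u i = (\sum_(s < P) (z ^+ (P - N + i)) ^+ s) * g i.
    rewrite /u fps_sum mulr_suml; apply: eq_bigr => s _; rewrite fpolyC_M /fps_rot.
    by rewrite mulrA -exprD -!exprM mulnC.
  apply: (@zero_estimate K {ffun 'I_m -> 'I_D} 'I_P E (fun s => fps_rot (z ^+ s) g) D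
    (fun s i => c' i \Po (z ^+ s *: 'X)) k B u N D_gt0) => //.
  - move=> s; rewrite -rmorphXn gD rmorph_sum; apply: eq_bigr => i _.
    by rewrite rmorphM rmorphXn /= fps_rot_poly.
  - by move=> s i; apply: size_comp_rot.
  (* Rotations of [g] stay in the span of [F], hence in that of the reduced monomials [E], whose
     number D^m does not depend on [N]. *)
  - move=> w; apply: (in_span_reduced_prod alg_fs D_gt0) => s.
    have Eg : in_span E (fps_rot (z ^+ s) g).
      apply: (in_span_trans EF).
      by apply: (rot_in_span (mahler_system_pow N p_gt0 sysF) P_gt0).
    elim: (nat_of_ord (w s)) => [|t IHt]; first exact: in_span_reduced1.
    by rewrite exprS; apply: in_span_reducedM.
  - move=> i lt_iN; rewrite uE (sum_unity_powers (zsP _)) ?mul0r //.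
    rewrite -(prim_order_dvd prim_z) gtnNdvd //; lia.
  rewrite uE subnK ?(ltnW lt_NP) // (prim_expr_order prim_z).
  rewrite (eq_bigr (fun=> 1)) => [|s _]; last by rewrite expr1n.
  rewrite sumr_const card_ord mulf_neq0 //.
  by rewrite -(prednK P_gt0); apply: char0.
exists (\poly_(i < (#|{ffun 'I_m -> 'I_D}| * B).+1) g i), (c D); split=> //.
apply/funext => i; rewrite fpolyE coef_poly ltnS -/g; case: leqP => // lt_i.
by apply/eqP; apply/negPn/negP => /bound; rewrite leqNgt lt_i.
Qed.

End AlgebraicMahler.

(** * Transfer to the definitions of the statement *)

Lemma ps_sum_eq0 (I : finType) (F : I -> fps Cplx) : ps_sum F = ps0 -> \sum_i F i = 0.
Proof. by move=> F0; apply/funext => n; rewrite fps_sum -[LHS]/(ps_sum F n) F0. Qed.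

Lemma ps_expE (f : fps Cplx) n : ps_exp f n = f ^+ n.
Proof.
elim: n => [|n IHn].
  by rewrite expr0; apply/funext => i; rewrite fps1 /ps_exp /= /ps1; case: eqP.
by rewrite exprS -IHn.
Qed.

Lemma mult_indep_expn p1 p2 k l : mult_indep p1 p2 -> (1 < p2)%N -> (p1 ^ k = p2 ^ l)%N -> l = 0%N.
Proof.
move=> indep p2_gt1 e; have [|_] := indep (Posz k) (- Posz l).
  rewrite -exprnN -exprnP -!pmulrn -!natrX e mulfV //.
  by rewrite pnatr_eq0 -lt0n expn_gt0 ltnW.
by move/eqP; rewrite oppr_eq0 => /eqP[].
Qed.

(** Order zero would leave a nonzero polynomial times [f] equal to 0, impossible for [f] nonzero;
    hence [0 < m]. *)
Lemma is_mahler_top p (f : fps Cplx) : (1 < p)%N -> is_mahler p f -> f <> 0 ->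
  exists m (a : nat -> {poly Cplx}), [/\ (0 < m)%N, a m != 0 &
    \sum_(i < m.+1) fpoly (a i) * fps_subst (p ^ i) f = 0].
Proof.
move=> p_gt1 [n [a [a_neq0 /ps_sum_eq0 rel]]] f_neq0.
have [m [c [cm_neq0 relc]]] := top_coefficient (h := fun i => fps_subst (p ^ i) f) rel a_neq0.
exists m, c; split=> //; case: m cm_neq0 relc => // c0_neq0.
rewrite big_ord1 expn0 fps_subst_id => /fps_mul_eq0[/eqP|//].
by rewrite fpoly_eq0 (negPf c0_neq0).
Qed.

Lemma Cplx_char0 n : n.+1%:R != 0 :> Cplx.
Proof. by rewrite pnatr_eq0. Qed.

Theorem theorem1p6 (p1 p2 : nat) (f g : pseries) :
  (2 <= p1)%N -> (2 <= p2)%N -> mult_indep p1 p2 ->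
  is_mahler p1 f -> is_mahler p2 g ->
  alg_indep f g \/ is_rational f \/ is_rational g.
Proof.
move=> p1_gt1 p2_gt1 indep mahf mahg.
(* A zero series is rational and is set aside, since [is_mahler_top] asks for a nonzero one. *)
have [f0|/(is_mahler_top p1_gt1 mahf)[m [a [m_gt0 am relf]]]] := pselect ((f : fps Cplx) = 0).
  right; left; exists 0, 1; rewrite oner_neq0; split=> //.
  by rewrite -[LHS]/(fpoly 1 * (f : fps Cplx)) f0 mulr0 -[RHS]/(fpoly 0) rmorph0.
have [g0|/(is_mahler_top p2_gt1 mahg)[m' [a' [m'_gt0 am' relg]]]] := pselect ((g : fps Cplx) = 0).
  right; right; exists 0, 1; rewrite oner_neq0; split=> //.
  by rewrite -[LHS]/(fpoly 1 * (g : fps Cplx)) g0 mulr0 -[RHS]/(fpoly 0) rmorph0.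
have [algf|algf] := pselect (algebraic_fps (f : fps Cplx)).
  by right; left; apply: (algebraic_mahler_rational Cplx_char0 p1_gt1 m_gt0 am relf algf).
have [algg|algg] := pselect (algebraic_fps (g : fps Cplx)).
  by right; right; apply: (algebraic_mahler_rational Cplx_char0 p2_gt1 m'_gt0 am' relg algg).
left=> N c rel; have [r [F [sysF FX _]]] := mahler_system_exists (ltnW p1_gt1) m_gt0 am relf N.
have [s [G [sysG GX _]]] := mahler_system_exists (ltnW p2_gt1) m'_gt0 am' relg N.
apply: (relation_algebraic p1_gt1 p2_gt1 _ sysF sysG _ _ _ algf algg).
- by move=> k l; apply: mult_indep_expn.
- by move=> i; apply: FX; apply: ltnW.
- by move=> i; apply: GX; apply: ltnW.
have := ps_sum_eq0 rel; rewrite pair_big /=; apply: etrans.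
by apply: eq_bigr => -[i j] _; rewrite /= !ps_expE.
Qed.
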